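(* For all $n\ge 2$ and all $m\ge 0$, $$h^0(\mathcal{T}_{\mathbb{P}^{n|m}})=n^2+m^2+2n\,|\,2nm+2m,$$ which equals $\dim\mathfrak{sl}(n+1|m)$.
   Context: The complex projective superspace $\mathbb{P}^{n|m}$ is the quotient of $(\mathbb{C}^{n+1|m})^\times$ (the restriction of $\mathbb{C}^{n+1|m}$ to $\mathbb{C}^{n+1}\setminus\{0\}$) by the $\mathbb{C}^*$-action scaling all even and odd coordinates by $\lambda$. $\mathcal{T}_{\mathbb{P}^{n|m}}$ is its tangent sheaf, i.e. the sheaf of superderivations of the structure sheaf, and $h^0=a|b$ means that the space $H^0$ of global sections has even dimension $a$ and odd dimension $b$. $\mathfrak{sl}(n+1|m)$ is the Lie superalgebra of $(n+1|m)\times(n+1|m)$ complex supermatrices of supertrace zero. *)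

(* Defs.v *)
From HB Require Import structures.
From mathcomp Require Import all_boot all_order all_algebra.
From mathcomp Require Import boolp classical_sets functions reals complex.
From mathcomp Require Import mpoly.

Set Implicit Arguments.
Unset Strict Implicit.
Unset Printing Implicit Defensive.

Import GRing.Theory.
Local Open Scope ring_scope.

(* The exterior algebra on m odd generators t_0, ..., t_(m-1): the function a *)
(* stands for \sum_I a I *: t_I, with t_I the product of the t_i, i \in I, in *)
(* increasing order of indices.                                               *)
Definition grassmann (K : fieldType) (m : nat) : lmodType K :=
  {ffun {set 'I_m} -> K^o}.

(* t_I * t_J = (-1) ^+ inversions I J *: t_(I :|: J) for disjoint I and J. *)
Definition inversions (m : nat) (I J : {set 'I_m}) : nat :=
  #|[set p : 'I_m * 'I_m | [&& p.1 \in I, p.2 \in J & (p.2 < p.1)%N]]|.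

Definition gmul (K : fieldType) (m : nat) (a b : grassmann K m) :
    grassmann K m :=
  [ffun L : {set 'I_m} =>
    (\sum_(I : {set 'I_m} | I \subset L)
      (-1) ^+ inversions I (L :\: I) * (a I : K) * (b (L :\: I) : K) : K^o)].

Section ProjectiveSuperspace.
(* Algebraic category: P^n is a classical variety, whose points are K-points  *)
(* and whose topology is the Zariski topology.                                *)
Variables (K : closedFieldType) (n m : nat).

Local Notation point := 'rV[K]_n.+1.

Definition evalp (p : {mpoly K[n.+1]}) (x : point) : K :=
  p.@[fun i => x ord0 i].

(* The open subsets of P^n, for the quotient topology of the Zariski topology *)
(* on K^(n+1) \ {0}; each of them is given by its preimage in K^(n+1) \ {0}.  *)
Record popen := POpen {
  cone :> set point;
  cone_neq0 : forall x, cone x -> x != 0;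
  cone_scale : forall (l : K) x, l != 0 -> cone x -> cone (l *: x);
  cone_open : forall x, cone x -> exists h : {mpoly K[n.+1]},
    evalp h x != 0 /\ forall y, y != 0 -> evalp h y != 0 -> cone y }.

Local Notation pts U := {x : point | cone U x}.

Lemma popenT_scale (l : K) (x : point) : l != 0 -> x != 0 -> l *: x != 0.
Proof. by move=> l0 x0; rewrite scaler_eq0 negb_or l0. Qed.

Lemma popenT_open (x : point) : x != 0 -> exists h : {mpoly K[n.+1]},
  evalp h x != 0 /\ forall y, y != 0 -> evalp h y != 0 -> y != 0.
Proof. by move=> _; exists 1%:MP; rewrite /evalp rmorph1 oner_neq0. Qed.

Definition popenT : popen :=
  @POpen (fun x => x != 0) (fun _ x0 => x0) popenT_scale popenT_open.

Definition regular_on (U : popen) (f : pts U -> K) : Prop :=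
  forall x : pts U, exists g h : {mpoly K[n.+1]},
    evalp h (sval x) != 0 /\
    forall y : pts U, evalp h (sval y) != 0 ->
      f y = evalp g (sval y) / evalp h (sval y).

(* A function f : U -> grassmann K m is read as the superfunction             *)
(* \sum_I f_I(x) t_I on the restriction of K^(n+1|m) to U.                    *)
Definition superfunction (U : popen) : lmodType K :=
  pts U -> grassmann K m.

Definition sregular (U : popen) (f : superfunction U) : Prop :=
  forall I : {set 'I_m}, regular_on (fun x : pts U => f x I : K).

(* l acts on superfunctions by the substitution x_i := l x_i, t_j := l t_j.   *)
Definition sinvariant (U : popen) (f : superfunction U) : Prop :=
  forall (l : K) (x y : pts U), l != 0 -> sval y = l *: sval x ->
  forall I : {set 'I_m}, l ^+ #|I| * (f y I : K) = f x I.

(* The structure sheaf of P^(n|m): its sections over an open subset of P^n    *)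
(* are the invariant regular superfunctions on the preimage.                  *)
Definition structure_pred (U : popen) : {pred superfunction U} :=
  fun f => `[< sregular f /\ sinvariant f >].

Lemma regular_on0 (U : popen) : regular_on (fun _ : pts U => 0).
Proof.
move=> x; exists 0, 1%:MP; rewrite /evalp rmorph1 oner_neq0; split=> // y _.
by rewrite raddf0 mul0r.
Qed.

Lemma regular_onD (U : popen) (f g : pts U -> K) :
  regular_on f -> regular_on g -> regular_on (fun x => f x + g x).
Proof.
move=> rf rg x; have [a [b [b0 fE]]] := rf x; have [c [d [d0 gE]]] := rg x.
exists (a * d + c * b), (b * d); rewrite /evalp !rmorphM mulf_neq0 //.
split=> // y; rewrite rmorphM mulf_eq0 negb_or => /andP[by0 dy0].
by rewrite fE // gE // raddfD /= !rmorphM /= addf_div.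
Qed.

Lemma regular_onM (U : popen) (f g : pts U -> K) :
  regular_on f -> regular_on g -> regular_on (fun x => f x * g x).
Proof.
move=> rf rg x; have [a [b [b0 fE]]] := rf x; have [c [d [d0 gE]]] := rg x.
exists (a * c), (b * d); rewrite /evalp !rmorphM mulf_neq0 //.
split=> // y; rewrite rmorphM mulf_eq0 negb_or => /andP[by0 dy0].
by rewrite fE // gE // !rmorphM /= mulf_div.
Qed.

Lemma regular_onC (U : popen) (c : K) : regular_on (fun _ : pts U => c).
Proof.
move=> x; exists c%:MP, 1%:MP; rewrite /evalp rmorph1 oner_neq0.
by split=> // y _; rewrite mevalC rmorph1 divr1.
Qed.

Lemma structure_submod (U : popen) : submod_closed (@structure_pred U).
Proof.
split.
  apply/asboolP; split=> [I|l x y _ _ I].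
    rewrite (_ : (fun _ => _) = fun=> 0); first exact: regular_on0.
    by apply/funext => x; rewrite /= ffunE.
  by rewrite !ffunE mulr0.
move=> c f g /asboolP[rf sf] /asboolP[rg sg]; apply/asboolP; split=> [I|].
  rewrite (_ : (fun _ => _) = fun x => c * (f x I : K) + (g x I : K)).
    by apply: regular_onD (rg I); apply: regular_onM (rf I); apply: regular_onC.
  by apply/funext => x; rewrite /= !ffunE.
move=> l x y l0 xy I; rewrite !ffunE mulrDr (sg _ _ _ l0 xy); congr (_ + _).
by rewrite -(sf _ _ _ l0 xy) [LHS]mulrCA.
Qed.

HB.instance Definition _ (U : popen) :=
  GRing.isSubmodClosed.Build K (superfunction U) (@structure_pred U)
    (structure_submod U).

Record osheaf (U : popen) := OSheaf {
  osval :> pts U -> grassmann K m;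
  _ : osval \in @structure_pred U }.

HB.instance Definition _ (U : popen) := [isSub for @osval U].
HB.instance Definition _ (U : popen) := [Choice of osheaf U by <:].
HB.instance Definition _ (U : popen) :=
  [SubChoice_isSubLmodule of osheaf U by <:].

Lemma omul_subproof (U : popen) (f g : osheaf U) :
  (fun x => gmul (f x) (g x)) \in @structure_pred U.
Proof.
have /asboolP[rf sf] := valP f; have /asboolP[rg sg] := valP g.
apply/asboolP; split=> [I|l x y l0 xy I].
  rewrite (_ : (fun _ => _) = fun x : pts U =>
    \sum_(J : {set 'I_m} | J \subset I)
     (-1) ^+ inversions J (I :\: J) * (f x J : K) * (g x (I :\: J) : K)).
    elim: (index_enum _) => [|J s IHs].
      rewrite (_ : (fun _ => _) = fun=> 0); first exact: regular_on0.
      by apply/funext => x; rewrite big_nil.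
    case JI: (J \subset I); last first.
      rewrite [X in regular_on X](_ : _ = fun x : pts U =>
        \sum_(J <- s | J \subset I) (-1) ^+ inversions J (I :\: J) *
        (f x J : K) * (g x (I :\: J) : K)); first exact: IHs.
      by apply/funext => x; rewrite big_cons JI.
    rewrite [X in regular_on X](_ : _ = fun x : pts U =>
       (-1) ^+ inversions J (I :\: J) * (f x J : K) * (g x (I :\: J) : K) +
        \sum_(J <- s | J \subset I) (-1) ^+ inversions J (I :\: J) *
        (f x J : K) * (g x (I :\: J) : K)).
      apply: regular_onD IHs; apply: regular_onM (rg _).
      by apply: regular_onM (rf _); apply: regular_onC.
    by apply/funext => x; rewrite big_cons JI.
  by apply/funext => x; rewrite /= ffunE.
rewrite !ffunE mulr_sumr; apply: eq_bigr => J JI.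
rewrite -(sf _ _ _ l0 xy J) -(sg _ _ _ l0 xy (I :\: J)).
rewrite -(cardsID J I) (finset.setIidPr JI) exprD.
by rewrite mulrACA; congr (_ * _); apply: mulrCA.
Qed.

Definition omul (U : popen) (f g : osheaf U) : osheaf U :=
  OSheaf (omul_subproof f g).

Definition subopen (V U : popen) : Prop := forall x, cone V x -> cone U x.

Definition subpoint (U V : popen) (VU : subopen V U) (x : pts V) :
    pts U :=
  exist _ (sval x) (VU _ (svalP x)).

Lemma ores_subproof (U V : popen) (VU : subopen V U) (f : osheaf U) :
  (fun x => f (subpoint VU x)) \in @structure_pred V.
Proof.
have /asboolP[rf sf] := valP f.
apply/asboolP; split=> [I x|l x y l0 xy I]; last exact: sf.
have [g [h [h0 fE]]] := rf I (subpoint VU x).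
by exists g, h; split=> // y hy; apply: fE.
Qed.

Definition ores (U V : popen) (VU : subopen V U) (f : osheaf U) : osheaf V :=
  OSheaf (ores_subproof VU f).

(* Parities are booleans: false is even, true is odd. *)
Definition homogeneous (U : popen) (q : bool) (f : osheaf U) : Prop :=
  forall x (I : {set 'I_m}), odd #|I| != q -> f x I = 0.

Lemma osheafP (U : popen) (f g : osheaf U) :
  (forall x I, f x I = g x I) -> f = g.
Proof.
move=> fg; apply: val_inj; apply: funext => x; apply/ffunP => I; apply: fg.
Qed.

Lemma osheafZD (U : popen) (c : K) (f g : osheaf U) x (I : {set 'I_m}) :
  (c *: f + g) x I = c * (f x I : K) + (g x I : K).
Proof.
have -> : (c *: f + g) x = c *: f x + g x.
  by rewrite -[X in X x = _]/(\val (c *: f + g)) linearP.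
by rewrite !ffunE.
Qed.

Lemma omul_linearl (U : popen) (g : osheaf U) : linear (fun f => omul f g).
Proof.
move=> c f f'; apply: osheafP => x I; rewrite osheafZD /= !ffunE mulr_sumr.
rewrite -big_split; apply: eq_bigr => J _; rewrite osheafZD /=.
by rewrite mulrDr mulrDl [_ * (c * _)]mulrCA !mulrA.
Qed.

Lemma omul_linearr (U : popen) (f : osheaf U) : linear (omul f).
Proof.
move=> c g g'; apply: osheafP => x I; rewrite osheafZD /= !ffunE mulr_sumr.
rewrite -big_split; apply: eq_bigr => J _; rewrite osheafZD /=.
by rewrite mulrDr [_ * (c * _)]mulrCA !mulrA.
Qed.

Lemma ores_linear (U V : popen) (VU : subopen V U) : linear (ores VU).
Proof.
move=> c f g; apply: osheafP => x I; rewrite [RHS]osheafZD.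
exact: (osheafZD c f g (subpoint VU x) I).
Qed.

(* Families of operations on the sections over the open subsets of W. *)
Definition operation (W : popen) : Type :=
  forall V : popen, subopen V W -> osheaf V -> osheaf V.

Section OperationModule.
Variable W : popen.
Implicit Types D E F : operation W.

Let op0 : operation W := fun V VW f => 0.
Let opN D : operation W := fun V VW f => - D V VW f.
Let opD D E : operation W := fun V VW f => D V VW f + E V VW f.
Let opZ (c : K) D : operation W := fun V VW f => c *: D V VW f.

Let opP D E : (forall V VW f, D V VW f = E V VW f) -> D = E.
Proof.
move=> DE; apply: functional_extensionality_dep => V.
by apply: functional_extensionality_dep => VW; apply: funext => f.
Qed.

Let opA : associative opD.
Proof. by move=> D E F; apply: opP => V VW f; apply: addrA. Qed.
Let opC : commutative opD.
Proof. by move=> D E; apply: opP => V VW f; apply: addrC. Qed.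
Let op0D : left_id op0 opD.
Proof. by move=> D; apply: opP => V VW f; apply: add0r. Qed.
Let opND : left_inverse op0 opN opD.
Proof. by move=> D; apply: opP => V VW f; apply: addNr. Qed.

HB.instance Definition _ := gen_eqMixin (operation W).
HB.instance Definition _ := gen_choiceMixin (operation W).
HB.instance Definition _ :=
  GRing.isZmodule.Build (operation W) opA opC op0D opND.

Let opZA (a b : K) D : opZ a (opZ b D) = opZ (a * b) D.
Proof. by apply: opP => V VW f; apply: scalerA. Qed.
Let op1Z : left_id 1 opZ.
Proof. by move=> D; apply: opP => V VW f; apply: scale1r. Qed.
Let opZDr : right_distributive opZ +%R.
Proof. by move=> a D E; apply: opP => V VW f; apply: scalerDr. Qed.
Let opZDl D : {morph opZ^~ D : a b / a + b}.
Proof. by move=> a b; apply: opP => V VW f; apply: scalerDl. Qed.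

HB.instance Definition _ :=
  GRing.Zmodule_isLmodule.Build K (operation W) opZA op1Z opZDr opZDl.

End OperationModule.

(* D is a superderivation of parity p of the restriction to W of the          *)
(* structure sheaf: a K-linear morphism of sheaves, of degree p, satisfying   *)
(* the super Leibniz rule.                                                    *)
Record superderivation (p : bool) (W : popen) (D : operation W) : Prop :=
  Superderivation {
  sder_linear : forall V (VW : subopen V W), linear (D V VW);
  sder_res : forall V V' (VW : subopen V W) (V'W : subopen V' W)
      (V'V : subopen V' V) f,
    ores V'V (D V VW f) = D V' V'W (ores V'V f);
  sder_parity : forall V (VW : subopen V W) q f,
    homogeneous q f -> homogeneous (p (+) q) (D V VW f);
  sder_leibniz : forall V (VW : subopen V W) q f g, homogeneous q f ->
    D V VW (omul f g) =
      omul (D V VW f) g + (-1) ^+ (p && q) *: omul f (D V VW g) }.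

Definition tangent_pred (p : bool) (W : popen) : {pred operation W} :=
  fun D => `[< superderivation p D >].

Lemma tangent_submod (p : bool) (W : popen) : submod_closed (@tangent_pred p W).
Proof.
have lin0 (U V : lmodType K) (h : U -> V) : linear h -> h 0 = 0.
  by move=> hL; have := hL (-1) 0 0; rewrite !scaleN1r addr0 oppr0 addNr.
split.
  apply/asboolP; split=> [V VW c f g|V V' VW V'W V'V f|V VW q f hf x I hI|].
  - by rewrite -[RHS]/(c *: 0 + 0) scaler0 addr0.
  - exact: lin0 (ores_linear V'V).
  - by rewrite -[LHS]/((\val (0 : osheaf V)) x I) raddf0 ffunE.
  - move=> V VW q f g hf.
    rewrite -[LHS]/0 -[X in omul X g]/0 -[X in omul f X]/0.
    rewrite (lin0 _ _ _ (omul_linearl g)) (lin0 _ _ _ (omul_linearr f)).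
    by rewrite scaler0 addr0.
move=> c D E /asboolP[Dl Dr Dp DL] /asboolP[El Er Ep EL]; apply/asboolP.
have opE V VW f : (c *: D + E) V VW f = c *: D V VW f + E V VW f by [].
move: (c *: D + E) opE => F opE.
split=> [V VW a f g|V V' VW V'W V'V f|V VW q f hf x I hI|V VW q f g hf].
- by rewrite !opE Dl El !scalerDr addrACA !scalerA [c * a]mulrC.
- by rewrite !opE ores_linear Dr Er.
- by rewrite opE osheafZD (Dp _ _ _ _ hf) // (Ep _ _ _ _ hf) // mulr0 addr0.
- rewrite !opE (DL _ _ _ _ _ hf) (EL _ _ _ _ _ hf) omul_linearl omul_linearr.
  by rewrite !scalerDr !scalerA addrACA [c * _]mulrC.
Qed.

HB.instance Definition _ (p : bool) (W : popen) :=
  GRing.isSubmodClosed.Build K (operation W) (@tangent_pred p W)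
    (tangent_submod p W).

(* Sections over W of the part of parity p of the tangent sheaf. *)
Record tangent (p : bool) (W : popen) := Tangent {
  tval : operation W;
  _ : tval \in @tangent_pred p W }.

HB.instance Definition _ (p : bool) (W : popen) := [isSub for @tval p W].
HB.instance Definition _ (p : bool) (W : popen) :=
  [Choice of tangent p W by <:].
HB.instance Definition _ (p : bool) (W : popen) :=
  [SubChoice_isSubLmodule of tangent p W by <:].

End ProjectiveSuperspace.

(* Vector.axiom d V is the type of linear bijections from V to 'rV_d. *)
Definition has_dim (K : fieldType) (V : lmodType K) (d : nat) : Prop :=
  inhabited (Vector.axiom d V).

(* H^0 is the sum of the spaces of even and of odd global superderivations.   *)
Definition h0_tangent (K : closedFieldType) (n m a b : nat) : Prop :=
  has_dim (tangent m false (popenT K n)) a /\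
  has_dim (tangent m true (popenT K n)) b.

Section SpecialLinear.
Variables (K : fieldType) (p q : nat).

Definition supertrace (A : 'M[K]_(p + q)) : K^o :=
  \tr (ulsubmx A) - \tr (drsubmx A).

Definition evenpart (A : 'M[K]_(p + q)) : 'M[K]_(p + q) :=
  block_mx (ulsubmx A) 0 0 (drsubmx A).

Definition oddpart (A : 'M[K]_(p + q)) : 'M[K]_(p + q) :=
  block_mx 0 (ursubmx A) (dlsubmx A) 0.

Lemma supertrace_linear : linear supertrace.
Proof.
move=> c A B; rewrite /supertrace /ulsubmx /drsubmx !linearP /= opprD addrACA.
by rewrite -[_ *: (_ - _)]/(c * (_ - _)) mulrBr.
Qed.

Lemma evenpart_linear : linear evenpart.
Proof.
move=> c A B; rewrite /evenpart /ulsubmx /drsubmx !linearP /=.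
rewrite scale_block_mx add_block_mx.
by rewrite !scaler0 !addr0.
Qed.

Lemma oddpart_linear : linear oddpart.
Proof.
move=> c A B; rewrite /oddpart /ursubmx /dlsubmx !linearP /=.
rewrite scale_block_mx add_block_mx.
by rewrite !scaler0 !addr0.
Qed.

HB.instance Definition _ :=
  GRing.isLinear.Build K 'M[K]_(p + q) K^o *:%R supertrace supertrace_linear.
HB.instance Definition _ :=
  GRing.isLinear.Build K 'M[K]_(p + q) 'M[K]_(p + q) *:%R evenpart
    evenpart_linear.
HB.instance Definition _ :=
  GRing.isLinear.Build K 'M[K]_(p + q) 'M[K]_(p + q) *:%R oddpart
    oddpart_linear.

Definition sl : {vspace 'M[K]_(p + q)} := lker (linfun supertrace).

(* The even and the odd dimension of sl(p|q); a supermatrix is even (odd) if  *)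
(* its odd (even) part vanishes.                                              *)
Definition sl_sdim : nat * nat :=
  (\dim (sl :&: lker (linfun oddpart))%VS,
   \dim (sl :&: lker (linfun evenpart))%VS).

End SpecialLinear.

(* Main.v *)
Require Import Defs.
From HB Require Import structures.
From mathcomp Require Import all_boot all_order all_algebra.
From mathcomp Require Import boolp classical_sets functions reals complex.
From mathcomp Require Import mpoly ring zify fintype finset.

(** Let x_0, ..., x_n be the even and t_1, ..., t_m the odd homogeneous
    coordinates, and z = (x, t). Every global superderivation comes from a
    linear vector field sum_(u,v) M_uv z_v d/dz_u on the cone, and M is unique
    up to a multiple of the Euler field, that is, up to a scalar matrix. The
    dimension is therefore that of gl(n+1|m) modulo scalars, which equals that
    of sl(n+1|m).

    A derivation D of the structure sheaf is determined by the sections D (x_k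
    / x_i) and D (t_a / x_i) on the standard charts, since a function of weight
    0 is near every point a fraction in the affine coordinates
    (derivation_eq0). On each chart D lifts to a vector field A on the cone,
    unique up to the Euler field x, so the bivector x ^ A is defined on all of
    K^(n+1) minus the origin (bivector). The coefficient of t_I in its
    components is regular and homogeneous of degree 2 - #|I|.

    Such functions are studied on affine lines, where a regular function is a
    polynomial (regular_line_poly), whose degree is bounded by homogeneity
    (weighted_line). Hence the coefficients with #|I| > 2 vanish, those with
    #|I| = 2 are constant, those with #|I| = 1 are linear, and those with #|I|
    = 0 are quadratic on each plane. Together with the identity x ^ (x ^ A) = 0
    this forces x ^ A to vanish as soon as finitely many of its values do:
    bivector_const0, bivector_linear0 and bivector_quadratic0, the latter being
    the fact that a vector field on projective space with sufficiently many
    zeros in general position is zero. In cohomological terms this is the Euler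
    sequence and the vanishing of the first cohomology of O(-d) on P^n; the
    hypothesis n >= 2 enters for #|I| = d = 2. Once x ^ A = 0, the odd
    coefficients are global functions of degree 1 - #|I|, treated in the same
    way. So D is zero if its matrix coef, normalised by M_00 = 0, is zero
    (normalized_eq0).

    Conversely each z_v d/dz_u acts on sections as a superderivation
    (vfield_superderivation), and coef recovers the matrix (coef_vfield). Hence
    the part of parity p of H^0 is isomorphic to the space of supermatrices of
    parity p with zero corner entry (tangent_dim). The even ones form a
    hyperplane among all even supermatrices, like those of supertrace zero; in
    the odd case neither condition is a restriction. *)

Set Implicit Arguments.
Unset Strict Implicit.
Unset Printing Implicit Defensive.

Import GRing.Theory.
Local Open Scope ring_scope.

(** * Polynomials and germs of fractions *)

Lemma mpoly_ring_ind (R : comNzRingType) k (P : {mpoly R[k]} -> Prop) :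
  (forall c, P c%:MP) -> (forall i, P 'X_i) ->
  (forall p q, P p -> P q -> P (p + q)) ->
  (forall p q, P p -> P q -> P (p * q)) -> forall p, P p.
Proof.
move=> PC PX PD PM p; rewrite [p]mpolyE.
apply: (big_ind P); [by rewrite -mpolyC0; apply: PC | exact: PD | move=> mm _].
rewrite -mul_mpolyC; apply: (PM) => //; rewrite mpolyXE_id.
have P1 : P 1 by rewrite -mpolyC1; apply: PC.
apply: (big_ind P); [exact: P1 | exact: PM | move=> i _].
by elim: (mm i) => [|d IH]; rewrite ?expr0 // exprS; apply: PM.
Qed.

Section OneVariable.
Variable K : closedFieldType.
Implicit Types (p q g h : {poly K}) (phi psi : K -> K).

(** A closed field is infinite: (p - q) * r has every scalar as a root. *)
Lemma poly_eq_off p q r : r != 0 ->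
  (forall s, r.[s] != 0 -> p.[s] = q.[s]) -> p = q.
Proof.
move=> r0 pq; apply/eqP; rewrite -subr_eq0 -[_ == 0]orbF -(negbTE r0) -mulf_eq0.
apply/negPn/negP => /closed_nonrootP[s]; rewrite /root hornerM mulf_eq0 negb_or.
by rewrite hornerD hornerN => /andP[/[swap] /pq ->]; rewrite subrr eqxx.
Qed.

Definition fraction_of phi g h : Prop :=
  forall s, h.[s] != 0 -> phi s = g.[s] / h.[s].

Lemma fraction_unique phi g h g' h' : h != 0 -> h' != 0 ->
  fraction_of phi g h -> fraction_of phi g' h' -> g * h' = g' * h.
Proof.
move=> h0 h0' r r'; apply: (@poly_eq_off _ _ (h * h'));
  first by rewrite mulf_neq0.
move=> s; rewrite !hornerM mulf_eq0 negb_or => /andP[hs hs'].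
by apply/eqP; rewrite -eqr_div // -r // -r'.
Qed.

(** The value at 0 of the derivative of the fraction g / h. *)
Definition fraction_deriv g h : K :=
  (g^`().[0] * h.[0] - g.[0] * h^`().[0]) / h.[0] ^+ 2.

Lemma fraction_deriv_unique phi g h g' h' : h.[0] != 0 -> h'.[0] != 0 ->
  fraction_of phi g h -> fraction_of phi g' h' ->
  fraction_deriv g h = fraction_deriv g' h'.
Proof.
move=> h0 h0' r r'.
have nz p : p.[0] != 0 -> p != 0 by apply: contraNneq => ->; rewrite horner0.
have E := fraction_unique (nz _ h0) (nz _ h0') r r'.
have /(congr1 (fun p => p.[0])) E0 := E; rewrite !hornerM in E0.
have /(congr1 (fun p => p^`().[0])) := E.
rewrite !derivM !hornerD !hornerM /fraction_deriv => E1.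
apply/eqP; rewrite eqr_div ?expf_neq0 //; apply/eqP.
move: E0 E1; set a := g.[0]; set b := h.[0]; set c := g'.[0]; set d := h'.[0].
set a' := g^`().[0]; set b' := _^`().[0]; set c' := _^`().[0] => E0.
set d' := _^`().[0] => E1.
have -> : (a' * b - a * b') * d ^+ 2 =
  (a' * d + a * d') * (b * d) - (a * d) * (d' * b + d * b') by ring.
rewrite E0 E1; ring.
Qed.

(** Differentiation makes sense without any topology on K: a function which is
    a fraction near 0 has the derivative of that fraction, whichever is
    chosen. *)
Definition germ_deriv phi : K := xget 0 [set d | exists g h,
  [/\ h.[0] != 0, fraction_of phi g h & d = fraction_deriv g h]]%classic.

Lemma germ_derivE phi g h : h.[0] != 0 -> fraction_of phi g h ->
  germ_deriv phi = fraction_deriv g h.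
Proof.
move=> h0 r; apply: xget_unique; first by exists g, h.
by move=> d [g' [h' [h0' r' ->]]]; apply: fraction_deriv_unique h0' h0 r' r.
Qed.

Definition germ phi : Prop := exists g h, h.[0] != 0 /\ fraction_of phi g h.

Lemma germ_derivD phi psi : germ phi -> germ psi ->
  germ_deriv (fun s => phi s + psi s) = germ_deriv phi + germ_deriv psi.
Proof.
move=> [g [h [h0 r]]] [g' [h' [h0' r']]].
rewrite (germ_derivE h0 r) (germ_derivE h0' r').
rewrite (@germ_derivE _ (g * h' + g' * h) (h * h')).
- rewrite /fraction_deriv !derivE ?(hornerD, hornerM, hornerZ, hornerC,
  hornerX); field; exact/andP.
- by rewrite hornerM mulf_neq0.
- move=> s; rewrite !(hornerD, hornerM) mulf_eq0 negb_or => /andP[hs hs'].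
  by rewrite r // r' // addf_div.
Qed.

Lemma germ_derivM phi psi : germ phi -> germ psi ->
  germ_deriv (fun s => phi s * psi s) =
  germ_deriv phi * psi 0 + phi 0 * germ_deriv psi.
Proof.
move=> [g [h [h0 r]]] [g' [h' [h0' r']]].
rewrite (germ_derivE h0 r) (germ_derivE h0' r') r // r' //.
rewrite (@germ_derivE _ (g * g') (h * h')).
- rewrite /fraction_deriv !derivE ?(hornerD, hornerM, hornerZ, hornerC,
  hornerX); field; exact/andP.
- by rewrite hornerM mulf_neq0.
- move=> s; rewrite !(hornerD, hornerM) mulf_eq0 negb_or => /andP[hs hs'].
  by rewrite r // r' // mulf_div.
Qed.

Lemma germM phi psi : germ phi -> germ psi -> germ (fun s => phi s * psi s).
Proof.
move=> [g [h [h0 r]]] [g' [h' [h0' r']]]; exists (g * g'), (h * h').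
rewrite hornerM mulf_neq0 //; split=> // s.
by rewrite !hornerM mulf_eq0 negb_or => /andP[hs hs'];
  rewrite r // r' // mulf_div.
Qed.

Lemma germD phi psi : germ phi -> germ psi -> germ (fun s => phi s + psi s).
Proof.
move=> [g [h [h0 r]]] [g' [h' [h0' r']]]; exists (g * h' + g' * h), (h * h').
rewrite hornerM mulf_neq0 //; split=> // s.
rewrite !(hornerD, hornerM) mulf_eq0 negb_or => /andP[hs hs'].
by rewrite r // r' // addf_div.
Qed.

Lemma germ_deriv_local phi psi r : r.[0] != 0 ->
  (forall s, r.[s] != 0 -> phi s = psi s) -> germ psi ->
  germ_deriv phi = germ_deriv psi.
Proof.
move=> r0 E [g [h [h0 F]]].
rewrite (@germ_derivE phi (g * r) (h * r)).
- rewrite (germ_derivE h0 F) /fraction_deriv !derivE ?(hornerD, hornerM,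
  hornerZ, hornerC, hornerX); field; exact/andP.
- by rewrite hornerM mulf_neq0.
- move=> s; rewrite !hornerM mulf_eq0 negb_or => /andP[hs rs].
  by rewrite E // F // -mulf_div divff // mulr1.
Qed.

Lemma germ_deriv_scale phi l : germ phi ->
  germ_deriv (fun s => phi (l * s)) = l * germ_deriv phi.
Proof.
move=> [g [h [h0 F]]].
rewrite (germ_derivE h0 F).
rewrite (@germ_derivE _ (g \Po (l *: 'X)) (h \Po (l *: 'X))).
- rewrite /fraction_deriv !deriv_comp !derivE !(hornerM, horner_comp, hornerZ,
  hornerX, hornerC).
  rewrite !mulr0 !mulr1; field; exact: h0.
- by rewrite horner_comp !(hornerZ, hornerX) mulr0.
- by move=> s; rewrite !horner_comp !(hornerZ, hornerX) => hs; apply: F.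
Qed.

(** Reduce the fraction found near 0 to lowest terms g1 / h1. By Gauss's lemma
    h1 divides the denominator of the fraction found near any other point, so
    it has no root and is constant. *)
Lemma regular_line_poly phi :
  (forall s0, exists g h, h.[s0] != 0 /\ fraction_of phi g h) ->
  exists p, forall s, phi s = p.[s].
Proof.
move=> loc; have [g [h [h0 F]]] := loc 0.
have hn0 : h != 0 by apply: contraNneq h0 => ->; rewrite horner0.
pose d := gcdp g h; have dn0 : d != 0 by rewrite gcdp_eq0 negb_and hn0 orbT.
have Eg : g = (g %/ d) * d by rewrite divpK // dvdp_gcdl.
have Eh : h = (h %/ d) * d by rewrite divpK // dvdp_gcdr.
set g1 := g %/ d in Eg; set h1 := h %/ d in Eh.
have co : coprimep h1 g1.
  by rewrite coprimep_sym; apply: coprimep_div_gcd; rewrite hn0 orbT.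
have P s : h1.[s] != 0 /\ phi s = g1.[s] / h1.[s].
  have [g' [h' [h0' F']]] := loc s.
  have hn0' : h' != 0 by apply: contraNneq h0' => ->; rewrite horner0.
  have := fraction_unique hn0 hn0' F F'; rewrite Eg Eh mulrAC mulrA.
  move/(mulIf dn0) => E.
  have : h1 %| g1 * h' by rewrite E dvdp_mull.
  rewrite (Gauss_dvdpr _ co) => /dvdpP[c Eh'];
    rewrite Eh' hornerM mulf_eq0 in h0'.
  move: h0'; rewrite negb_or => /andP[cs hs]; split=> //.
  have -> : phi s = g'.[s] / h'.[s] by apply: F'; rewrite Eh' hornerM mulf_neq0.
  apply/eqP; rewrite eqr_div //; first by rewrite -!hornerM E eqxx.
  by rewrite Eh' hornerM mulf_neq0.
have /size_poly1P[c c0 Ec] : size h1 == 1%N.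
  apply/negPn/negP => /closed_rootP[x]; rewrite /root.
  by have [/negbTE ->] := P x.
exists (c^-1 *: g1) => s; have [_ ->] := P s.
by rewrite Ec hornerC hornerZ mulrC.
Qed.

(** Here p and q stand for s |-> F (u + s v) and s |-> F (v + s u), where F is
    homogeneous of degree w - d; the substitution s |-> 1 / s reverses the
    coefficients, so p has degree at most w - d, with top coefficient F v. *)
Lemma poly_homog_size p q d w :
  (forall s, s != 0 -> s ^+ d * p.[s] = s ^+ w * q.[s^-1]) ->
  (size p <= w.+1 - d)%N /\ ((d <= w)%N -> p`_(w - d) = q.[0]).
Proof.
move=> H; have [N qN] : exists N, (size q <= N.+1)%N by exists (size q).
pose q' := \poly_(i < N.+1) q`_(N - i).
have q'E s : s != 0 -> s ^+ N * q.[s^-1] = q'.[s].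
  move=> s0; rewrite horner_poly (horner_coef_wide _ qN) mulr_sumr.
  rewrite [LHS](reindex_inj rev_ord_inj) /=; apply: eq_bigr => i _.
  rewrite subSS mulrCA; congr (_ * _); rewrite exprVn.
  have iN : (i <= N)%N by rewrite -ltnS.
  by rewrite -{1}(subnK iN) exprD mulrAC divff ?expf_neq0 // mul1r.
have E : 'X^(d + N) * p = 'X^w * q'.
  apply: (@poly_eq_off _ _ 'X) => [|s]; first by rewrite polyX_eq0.
  rewrite hornerX => s0; rewrite !hornerM !hornerXn -q'E // exprD.
  by rewrite mulrAC H // mulrAC -mulrA.
split.
  apply/leq_sizeP => j jw; have /(congr1 (fun r : {poly K} =>
    r`_(d + N + j))) := E.
  rewrite !coefXnM ltnNge leq_addr /= addKn => ->.
  case: ifP => // /negbT; rewrite -leqNgt => wj; rewrite coef_poly.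
  by case: ifP => // ij; exfalso; lia.
move=> dw; have /(congr1 (fun r : {poly K} => r`_(w + N))) := E.
rewrite !coefXnM !ltnNge leq_add2r dw leq_addr /= addKn coef_poly ltnSn subnn.
by rewrite horner_coef0 subnDr.
Qed.

End OneVariable.

(** * The exterior algebra *)

Section Grassmann.
Variables (K : fieldType) (m : nat).
Implicit Types (a b : 'I_m) (I J L N : {set 'I_m}) (f g : grassmann K m).

Definition below a J : nat := \sum_(j in J) (j < a)%N.
Definition above a J : nat := \sum_(j in J) (a < j)%N.

Lemma inversionsE I J : inversions I J = (\sum_(i in I) below i J)%N.
Proof.
rewrite /inversions -sum1_card pair_big_dep /=.
rewrite [RHS](eq_bigl (fun p => [&& p.1 \in I & p.2 \in J])) //.
rewrite [RHS]big_mkcond [LHS]big_mkcond; apply: eq_bigr => p _.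
by rewrite inE; case: (p.1 \in I); case: (p.2 \in J) => //=; case: (_ < _)%N.
Qed.

Lemma inversionsUl a I J : a \notin I ->
  inversions (a |: I) J = (below a J + inversions I J)%N.
Proof. by move=> aI; rewrite !inversionsE big_setU1. Qed.

Lemma inversionsUr a I J : a \notin J ->
  inversions I (a |: J) = (above a I + inversions I J)%N.
Proof.
move=> aJ; rewrite !inversionsE -big_split; apply: eq_bigr => i _.
by rewrite /below big_setU1.
Qed.

Lemma below_above a I : a \notin I -> (below a I + above a I)%N = #|I|.
Proof.
move=> aI; rewrite /below /above -big_split -sum1_card; apply: eq_bigr => i iI.
by case: ltngtP => // /val_inj E; rewrite -E iI in aI.
Qed.

Lemma below_split a I L : I \subset L ->
  (below a I + below a (L :\: I))%N = below a L.
Proof.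
move=> IL; rewrite /below [RHS](bigID (mem I)) /=; congr (_ + _)%N.
  by apply: eq_bigl => i; case iI: (i \in I); rewrite ?andbF // (subsetP IL).
by apply: eq_bigl => i; rewrite in_setD andbC.
Qed.

Lemma belowU a I : a \notin I -> below a (a |: I) = below a I.
Proof. by move=> aI; rewrite /below big_setU1 // ltnn. Qed.

Lemma eq_sign (i j : nat) : odd i = odd j -> (-1) ^+ i = (-1) ^+ j :> K.
Proof. by move=> ij; rewrite -signr_odd ij signr_odd. Qed.

Lemma mul_sign3 e1 e2 e3 e4 e5 (x y : K) :
  odd e1 (+) odd e2 = odd e3 (+) odd e4 (+) odd e5 ->
  (-1) ^+ e1 * ((-1) ^+ e2 * x * y) =
  (-1) ^+ e3 * ((-1) ^+ e4 * x * ((-1) ^+ e5 * y)).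
Proof.
rewrite -!oddD => /eq_sign; rewrite !exprD => E.
transitivity ((-1) ^+ e1 * (-1) ^+ e2 * (x * y)); first by ring.
by rewrite E; ring.
Qed.

(** A subset of a |: N either omits a or is a |: I for a subset I of N. *)
Lemma sum_subsetU a N (F : {set 'I_m} -> K) : a \notin N ->
  \sum_(I : {set 'I_m} | I \subset a |: N) F I =
  \sum_(I : {set 'I_m} | I \subset N) F I +
  \sum_(I : {set 'I_m} | I \subset N) F (a |: I).
Proof.
move=> aN; rewrite (bigID (fun I : {set 'I_m} => a \in I)) /= addrC.
congr (_ + _).
  apply: eq_bigl => I; apply/andP/idP => [[IaN aI]|IN].
    apply/subsetP => i iI; move/subsetP/(_ i iI): IaN; rewrite !inE.
    by case/orP => // /eqP E; rewrite -E iI in aI.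
  split; first exact: subset_trans IN (subsetUr _ _).
  by apply: contra aN; apply/subsetP.
rewrite (reindex_onto (fun I => a |: I) (fun I => I :\ a)) /=; last first.
  by move=> I /andP[_ aI]; rewrite setD1K.
apply: eq_bigl => I; rewrite setU11 andbT; apply/andP/idP => [[IN /eqP E]|IN].
  apply/subsetP => i iI; move/subsetP/(_ i): IN;
    rewrite !inE iI orbT => /(_ isT).
  case/orP => // /eqP Ei; move: iI; rewrite Ei -E.
  by rewrite !inE eqxx.
split; first exact: setUS.
by apply/eqP; rewrite setU1K //; apply: contra aN; apply/subsetP.
Qed.

Lemma setDUl a N I : I \subset N -> a \notin N -> (a |: N) :\: I = a |: (N :\:
  I).
Proof.
move=> IN aN; apply/setP => i; rewrite !inE; case: eqP => [->|] //=;
  rewrite ?andbT.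
by apply: contra aN; apply/subsetP.
Qed.

Lemma setDUU a N I : a \notin N -> (a |: N) :\: (a |: I) = N :\: I.
Proof.
move=> aN; apply/setP => i; rewrite !inE negb_or.
by case: eqP => [->|] //=; rewrite (negbTE aN) andbF.
Qed.

(** Left multiplication by the generator t_b; the sign moves t_b to its
    place. *)
Definition gtmul b f : grassmann K m :=
  [ffun L : {set 'I_m} => if b \in L then (-1) ^+ below b L * (f (L :\ b) : K)
    else 0 : K^o].

(** The left derivative d/dt_a; the sign moves t_a to the front. *)
Definition gder a f : grassmann K m :=
  [ffun L : {set 'I_m} => if a \in L then 0 else (-1) ^+ below a L * (f (a |:
    L) : K) : K^o].

Definition ghomog (q : bool) f := forall I, odd #|I| != q -> f I = 0.

Lemma gtmulU b f I : b \notin I ->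
  gtmul b f (b |: I) = (-1) ^+ below b I * (f I : K).
Proof. by move=> bI; rewrite ffunE setU11 belowU // setU1K. Qed.

Lemma gtmul0 b f I : b \notin I -> gtmul b f I = 0.
Proof. by move=> bI; rewrite ffunE (negbTE bI). Qed.

Lemma gderU a f I : a \notin I ->
  gder a f I = (-1) ^+ below a I * (f (a |: I) : K).
Proof. by move=> aI; rewrite ffunE (negbTE aI). Qed.

Lemma gder0 a f I : a \in I -> gder a f I = 0.
Proof. by move=> aI; rewrite ffunE aI. Qed.

Lemma gscaleE (c : K) f I : (c *: f) I = c * (f I : K) :> K.
Proof. by rewrite ffunE. Qed.

Lemma gaddE f g I : (f + g) I = (f I : K) + (g I : K) :> K.
Proof. by rewrite ffunE. Qed.

Lemma gmulE f g L : gmul f g L =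
  \sum_(I : {set 'I_m} | I \subset L)
     (-1) ^+ inversions I (L :\: I) * (f I : K) * (g (L :\: I) : K).
Proof. by rewrite ffunE. Qed.

Lemma gtmul_gmull b f g : gtmul b (gmul f g) = gmul (gtmul b f) g.
Proof.
apply/ffunP => L; rewrite [RHS]gmulE; have [bL|bL] := boolP (b \in L);
  last first.
  rewrite gtmul0 // big1 // => I IL; rewrite gtmul0 ?mulr0 ?mul0r //.
  by apply: contra bL; apply/subsetP.
rewrite -(setD1K bL); set N := L :\ b; have bN : b \notin N by rewrite !inE
  eqxx.
rewrite gtmulU // gmulE mulr_sumr sum_subsetU // [X in X + _]big1 ?add0r.
  apply: eq_bigr => I IN; have bI : b \notin I by apply: contra bN;
    apply/subsetP.
  rewrite setDUU // gtmulU // inversionsUl // !mulrA -!exprD.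
  by congr (_ * _ * _); rewrite -(below_split b IN); apply: eq_sign; lia.
by move=> I IN; rewrite gtmul0 ?mulr0 ?mul0r //; apply: contra bN;
  apply/subsetP.
Qed.

(** The generator t_b has to pass f, which is homogeneous of parity q. *)
Lemma gtmul_gmulr q b f g : ghomog q f ->
  gtmul b (gmul f g) = (-1) ^+ q *: gmul f (gtmul b g).
Proof.
move=> fq; apply/ffunP => L; rewrite gscaleE gmulE.
have [bL|bL] := boolP (b \in L); last first.
  rewrite gtmul0 // big1 ?mulr0 // => I IL; rewrite gtmul0 ?mulr0 ?mul0r //.
  by rewrite !inE (negbTE bL) andbF.
rewrite -(setD1K bL); set N := L :\ b; have bN : b \notin N by rewrite !inE
  eqxx.
rewrite gtmulU // gmulE !mulr_sumr sum_subsetU // [X in _ = _ + X]big1 ?addr0.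
  apply: eq_bigr => I IN; have bI : b \notin I by apply: contra bN;
    apply/subsetP.
  have [qI|/fq ->] := eqVneq (odd #|I|) q; last by rewrite !(mulr0, mul0r).
  have bD : b \notin N :\: I by rewrite finset.in_setD (negbTE bN) andbF.
  rewrite setDUl // gtmulU ?inversionsUr //.
  rewrite -(below_split b IN) -qI.
  rewrite (mul_sign3 (e3 := odd #|I|) (e4 := above b I + inversions I (N :\: I))
     (e5 := below b (N :\: I))) // -(below_above bI) oddb !oddD.
  by case: (odd (below b I)) (odd (above b I)) (odd (below b (N :\: I)))
    (odd (inversions I (N :\: I))) => [] [] [] [].
move=> I IN; have bD : b \notin N :\: I by rewrite finset.in_setD (negbTE bN)
  andbF.
by rewrite setDUU // gtmul0 ?mulr0.
Qed.

(** For a outside L, split the subsets of a |: L by whether they contain a: the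
    two families give the two terms. For a in L the left side vanishes, and the
    terms of the right side indexed by I and a |: I cancel. *)
Lemma gder_leibniz q a f g : ghomog q f ->
  gder a (gmul f g) = gmul (gder a f) g + (-1) ^+ q *: gmul f (gder a g).
Proof.
move=> fq; apply/ffunP => L; rewrite gaddE gscaleE !gmulE.
have [aL|aL] := boolP (a \in L).
  rewrite -(setD1K aL); set N := L :\ a.
  have aN : a \notin N by rewrite !inE eqxx.
  rewrite gder0 ?setU11 // !sum_subsetU // [X in _ = _ + X + _]big1 ?addr0;
    last first.
    by move=> I IN; rewrite gder0 ?setU11 // mulr0 mul0r.
  rewrite [X in _ = _ + _ * (X + _)]big1 ?add0r; last first.
    by move=> I IN; rewrite setDUl // gder0 ?setU11 // mulr0.
  rewrite mulr_sumr -big_split big1 //= => I IN.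
  have aI : a \notin I by apply: contra aN; apply/subsetP.
  have aD : a \notin N :\: I by rewrite inE (negbTE aN) andbF.
  rewrite setDUl // setDUU // !gderU // inversionsUr // inversionsUl //.
  have [qI|/fq ->] := eqVneq (odd #|a |: I|) q;
    last by rewrite !(mulr0, mul0r, addr0).
  move: qI; rewrite cardsU1 aI -(below_above aI) oddD => <-.
  set x := f _; set y := g _; rewrite !exprD.
  set s1 := _ ^+ below a I; set s2 := _ ^+ above a I.
  set s3 := _ ^+ below a (N :\: I); set s4 := _ ^+ inversions I _.
  have -> : (-1) ^+ (odd true (+) odd (below a I + above a I)) = - (s1 * s2) :>
    K.
    by rewrite oddb signr_addb signr_odd exprD expr1 mulN1r.
  have /eqP s33 : s3 * s3 == 1 by rewrite -expr2 sqrr_sign.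
  transitivity ((1 - s3 * s3) * (s1 * s2 * s4 * (x : K) * y)); first by ring.
  by rewrite s33 subrr mul0r.
rewrite gderU // gmulE sum_subsetU // mulrDr addrC; congr (_ + _); last first.
  rewrite !mulr_sumr; apply: eq_bigr => I IL.
  have aI : a \notin I by apply: contra aL; apply/subsetP.
  have aD : a \notin L :\: I by rewrite inE (negbTE aL) andbF.
  have [qI|/fq ->] := eqVneq (odd #|I|) q; last by rewrite !(mulr0, mul0r).
  rewrite setDUl // gderU // inversionsUr // -(below_split a IL) -qI.
  apply: mul_sign3; rewrite -(below_above aI) oddb !oddD.
  by case: (odd (below a I)) (odd (above a I)) (odd (below a (L :\: I)))
    (odd (inversions I (L :\: I))) => [] [] [] [].
rewrite mulr_sumr; apply: eq_bigr => I IL.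
have aI : a \notin I by apply: contra aL; apply/subsetP.
rewrite setDUU // gderU // inversionsUl // -(below_split a IL).
rewrite !mulrA -!exprD; congr (_ * _ * _); apply: eq_sign; lia.
Qed.

Definition gone : grassmann K m := [ffun I : {set 'I_m} =>
  (I == finset.set0)%:R : K^o].

Lemma gmulZl (c : K) f g : gmul (c *: f) g = c *: gmul f g.
Proof.
apply/ffunP => L; rewrite gscaleE !gmulE mulr_sumr; apply: eq_bigr => I _.
by rewrite gscaleE; ring.
Qed.

Lemma gmulZr (c : K) f g : gmul f (c *: g) = c *: gmul f g.
Proof.
apply/ffunP => L; rewrite gscaleE !gmulE mulr_sumr; apply: eq_bigr => I _.
by rewrite gscaleE; ring.
Qed.

Lemma gmulDr f g g' : gmul f (g + g') = gmul f g + gmul f g'.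
Proof.
apply/ffunP => L; rewrite gaddE !gmulE -big_split; apply: eq_bigr => I _.
by rewrite gaddE mulrDr.
Qed.

Lemma gmul0g g : gmul 0 g = 0.
Proof. by rewrite -[X in gmul X](scale0r 0) gmulZl scale0r. Qed.

Lemma gmulg0 f : gmul f 0 = 0.
Proof. by rewrite -[X in gmul _ X](scale0r 0) gmulZr scale0r. Qed.

Lemma inversions0l J : inversions finset.set0 J = 0%N.
Proof. by rewrite inversionsE big_set0. Qed.

Lemma inversions0r I : inversions I finset.set0 = 0%N.
Proof. by rewrite inversionsE big1 // => i _; rewrite /below big_set0. Qed.

Lemma gmul1g f : gmul gone f = f.
Proof.
apply/ffunP => L; rewrite gmulE (bigD1 finset.set0) ?sub0set //= big1 ?addr0.
  by rewrite ffunE eqxx inversions0l setD0 !mul1r.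
by move=> I /andP[_ /negbTE I0]; rewrite ffunE I0 mulr0 mul0r.
Qed.

Lemma gmulg1 f : gmul f gone = f.
Proof.
apply/ffunP => L; rewrite gmulE (bigD1 L) //= big1 ?addr0.
  by rewrite ffunE finset.setDv eqxx inversions0r mul1r mulr1.
move=> I /andP[IL nIL]; rewrite ffunE setD_eq0.
by case: (boolP (L \subset I)) => LI; rewrite ?mulr0 //;
  rewrite eqEsubset IL LI in nIL.
Qed.

Lemma ghomog_gone : ghomog false gone.
Proof. by move=> I; rewrite ffunE; have [->|_ //] := eqVneq I finset.set0;
  rewrite cards0. Qed.

Lemma ghomog_gtmul q b f : ghomog q f -> ghomog (~~ q) (gtmul b f).
Proof.
move=> fq I; rewrite ffunE; case: ifP => // bI;
  rewrite (cardsD1 b) bI oddS => H.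
by rewrite fq ?mulr0 //; case: (odd _) q H {fq} => [] [].
Qed.

Lemma ghomog_gder q a f : ghomog q f -> ghomog (~~ q) (gder a f).
Proof.
move=> fq I; rewrite ffunE; case: ifP => // aI H.
by rewrite fq ?mulr0 // cardsU1 aI oddS; case: (odd _) q H {fq} => [] [].
Qed.

End Grassmann.

(** * Sections of the structure sheaf as functions on the cone *)

Section Sections.
Variables (K : closedFieldType) (n m : nat).
Local Notation point := 'rV[K]_n.+1.
Implicit Types (U V W : popen K n) (x y : point) (F G : point -> K).

Lemma evalpD (g h : {mpoly K[n.+1]}) x : evalp (g + h) x = evalp g x + evalp h
  x.
Proof. by rewrite /evalp raddfD. Qed.
Lemma evalpM (g h : {mpoly K[n.+1]}) x : evalp (g * h) x = evalp g x * evalp h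
  x.
Proof. by rewrite /evalp rmorphM. Qed.
Lemma evalpC c x : evalp c%:MP x = c.
Proof. by rewrite /evalp mevalC. Qed.
Lemma evalpX i x : evalp 'X_i x = x 0 i.
Proof. by rewrite /evalp mevalXU. Qed.

Lemma evalpN (g : {mpoly K[n.+1]}) x : evalp (- g) x = - evalp g x.
Proof. by rewrite /evalp raddfN. Qed.

(** A neighbourhood of x that avoids the origin: multiply by a coordinate that
    does not vanish at x. *)
Lemma popen_nbhd U x : cone U x ->
  exists h, evalp h x != 0 /\ forall y, evalp h y != 0 -> cone U y.
Proof.
move=> Ux; have /rV0Pn[i xi] := cone_neq0 Ux; have [h [hx hU]] := cone_open Ux.
exists ('X_i * h); rewrite evalpM evalpX mulf_neq0 //; split=> // y.
rewrite evalpM evalpX mulf_eq0 negb_or => /andP[yi hy]; apply: hU => //.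
by apply: contraNneq yi => ->; rewrite mxE.
Qed.

(** Sections are handled through functions on the whole of K^(n+1); the
    denominator h also witnesses that the neighbourhood lies in U. *)
Definition regular_at U F x : Prop := exists g h, evalp h x != 0 /\
  forall y, evalp h y != 0 -> cone U y /\ F y = evalp g y / evalp h y.

Definition regular_fun U F : Prop := forall x, cone U x -> regular_at U F x.

Definition homog_fun U d F : Prop :=
  forall l y, l != 0 -> cone U y -> l ^+ d * F (l *: y) = F y.

Lemma regular_fun_poly U (p : {mpoly K[n.+1]}) : regular_fun U (evalp p).
Proof.
move=> x /popen_nbhd[h [hx hU]]; exists (p * h), h; split=> // y hy.
by split; [exact: hU | rewrite evalpM mulfK].
Qed.

Lemma regular_fun_coord U i : regular_fun U (fun y => y 0 i).
Proof.
have -> : (fun y : point => y 0 i) = evalp 'X_i.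
  by apply/funext => y; rewrite evalpX.
exact: regular_fun_poly.
Qed.

Lemma regular_funC U c : regular_fun U (fun=> c).
Proof.
have -> : (fun y : point => c) = evalp c%:MP.
  by apply/funext => y; rewrite evalpC.
exact: regular_fun_poly.
Qed.

Lemma regular_funD U F G : regular_fun U F -> regular_fun U G ->
  regular_fun U (fun y => F y + G y).
Proof.
move=> rF rG x Ux; have [g [h [hx E]]] := rF x Ux.
have [g' [h' [hx' E']]] := rG x Ux; exists (g * h' + g' * h), (h * h').
rewrite evalpM mulf_neq0 //; split=> // y.
rewrite !(evalpM, evalpD) mulf_eq0 negb_or => /andP[hy hy'].
have [Uy ->] := E y hy; have [_ ->] := E' y hy'; split=> //.
by rewrite addf_div.
Qed.

Lemma regular_funM U F G : regular_fun U F -> regular_fun U G ->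
  regular_fun U (fun y => F y * G y).
Proof.
move=> rF rG x Ux; have [g [h [hx E]]] := rF x Ux.
have [g' [h' [hx' E']]] := rG x Ux; exists (g * g'), (h * h').
rewrite evalpM mulf_neq0 //; split=> // y.
rewrite !evalpM mulf_eq0 negb_or => /andP[hy hy'].
have [Uy ->] := E y hy; have [_ ->] := E' y hy'; split=> //.
by rewrite mulf_div.
Qed.

Lemma regular_funV U F : regular_fun U F -> (forall y, cone U y -> F y != 0) ->
  regular_fun U (fun y => (F y)^-1).
Proof.
move=> rF F0 x Ux; have [g [h [hx E]]] := rF x Ux.
have gx : evalp g x != 0.
  have [_ Fx] := E x hx; have := F0 x Ux; rewrite Fx.
  by rewrite mulf_eq0 negb_or => /andP[].
exists (h * h), (h * g); rewrite !evalpM !mulf_neq0 //; split=> // y.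
rewrite !evalpM mulf_eq0 negb_or => /andP[hy gy]; have [Uy ->] := E y hy.
by split=> //; rewrite invf_div -mulf_div divff // mul1r.
Qed.

Lemma regular_fun_sub U V F : subopen V U -> regular_fun U F -> regular_fun V F.
Proof.
move=> VU rF x Vx; have [g [h [hx E]]] := rF x (VU _ Vx).
have [u [ux uV]] := popen_nbhd Vx; exists (g * u), (h * u).
rewrite evalpM mulf_neq0 //; split=> // y.
rewrite !evalpM mulf_eq0 negb_or => /andP[hy uy]; split; first exact: uV.
by have [_ ->] := E y hy; rewrite -mulf_div divff // mulr1.
Qed.

Lemma regular_fun_eq U F G : (forall y, cone U y -> F y = G y) ->
  regular_fun U F -> regular_fun U G.
Proof.
move=> FG rF x Ux; have [g [h [hx E]]] := rF x Ux; exists g, h; split=> // y hy.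
by have [Uy Fy] := E y hy; rewrite -FG.
Qed.

Section NonVanishing.
Variables (V : popen K n) (F : point -> K).
Hypotheses (rF : regular_fun V F)
  (sF : forall l y, l != 0 -> cone V y -> F y != 0 -> F (l *: y) != 0).

Let c y := cone V y /\ F y != 0.
Let c_neq0 y : c y -> y != 0. Proof. by case=> /cone_neq0. Qed.
Let c_scale (l : K) y : l != 0 -> c y -> c (l *: y).
Proof. by move=> l0 [Vy Fy]; split; [exact: cone_scale | exact: sF]. Qed.
Let c_open x : c x -> exists h : {mpoly K[n.+1]},
  evalp h x != 0 /\ forall y, y != 0 -> evalp h y != 0 -> c y.
Proof.
move=> [Vx Fx]; have [g [h [hx E]]] := rF Vx; exists (h * g).
have [_ FE] := E x hx; move: Fx; rewrite FE mulf_eq0 negb_or => /andP[gx _].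
rewrite evalpM mulf_neq0 //; split=> // y _.
rewrite evalpM mulf_eq0 negb_or => /andP[hy gy]; have [Vy Fy] := E y hy.
by split=> //; rewrite Fy mulf_neq0 ?invr_neq0.
Qed.

Definition nonvanishing : popen K n := POpen c_neq0 c_scale c_open.

End NonVanishing.

Lemma coord_scale V i (l : K) y : l != 0 -> cone V y ->
  y 0 i != 0 -> (l *: y) 0 i != 0.
Proof. by move=> l0 _ yi; rewrite mxE mulf_neq0. Qed.

Definition chart V i : popen K n :=
  nonvanishing (@regular_fun_coord V i) (@coord_scale V i).

Lemma chart_sub V i : subopen (chart V i) V.
Proof. by move=> y []. Qed.

Lemma chartP V i y : cone (chart V i) y <-> cone V y /\ y 0 i != 0.
Proof. by []. Qed.

(** Extending by 0 outside of U removes the proof that y lies in U. *)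
Definition gval U (f : osheaf m U) y : grassmann K m :=
  if pselect (cone U y) is left H then f (exist _ y H) else 0.

Implicit Types (I : {set 'I_m}).

Lemma gvalE U (f : osheaf m U) y (Uy : cone U y) : gval f y = f (exist _ y Uy).
Proof.
rewrite /gval; case: pselect => // H; congr (osval f (exist _ _ _)).
exact: Prop_irrelevance.
Qed.

Lemma gval_out U (f : osheaf m U) y : ~ cone U y -> gval f y = 0.
Proof. by rewrite /gval; case: pselect. Qed.

Lemma gval_sval U (f : osheaf m U) (x : {x | cone U x}) : f x = gval f (sval x).
Proof. by case: x => x Ux; rewrite gvalE. Qed.

Lemma gval_inj U (f g : osheaf m U) :
  (forall y, cone U y -> gval f y = gval g y) -> f = g.
Proof.
by move=> fg; apply: osheafP => x I; rewrite !gval_sval fg //; apply: svalP.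
Qed.

Lemma gvalZD U (c : K) (f g : osheaf m U) y :
  gval (c *: f + g) y = c *: gval f y + gval g y.
Proof.
have [Uy|Uy] := pselect (cone U y); last by rewrite !gval_out // scaler0 addr0.
by rewrite !gvalE.
Qed.

Lemma gval_ores U V (VU : subopen V U) (f : osheaf m U) y : cone V y ->
  gval (ores VU f) y = gval f y.
Proof.
move=> Vy; rewrite (gvalE _ Vy) (gvalE _ (VU _ Vy)) /=.
by congr (osval f (exist _ _ _)); apply: Prop_irrelevance.
Qed.

Lemma gval_omul U (f g : osheaf m U) y :
  gval (omul f g) y = gmul (gval f y) (gval g y).
Proof.
have [Uy|Uy] := pselect (cone U y); first by rewrite !(gvalE _ Uy).
rewrite !gval_out //; apply/ffunP => I; rewrite gmulE big1 ?ffunE // => J _.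
by rewrite ffunE mulr0 mul0r.
Qed.

Lemma gval_regular U (f : osheaf m U) I : regular_fun U (fun y => gval f y I).
Proof.
have /asboolP[rf _] := valP f => x Ux.
have [g [h [hx E]]] := rf I (exist _ x Ux); have [u [ux uU]] := popen_nbhd Ux.
exists (g * u), (h * u); rewrite evalpM mulf_neq0 //; split=> // y.
rewrite !evalpM mulf_eq0 negb_or => /andP[hy uy]; have Uy := uU y uy.
split=> //; rewrite (gvalE _ Uy) [LHS](E (exist _ y Uy) hy) /=.
by rewrite -mulf_div divff // mulr1.
Qed.

Lemma gval_homog U (f : osheaf m U) I : homog_fun U #|I| (fun y => gval f y I).
Proof.
have /asboolP[_ sf] := valP f => l y l0 Uy.
have Uly : cone U (l *: y) by apply: cone_scale.
by rewrite (gvalE _ Uy) (gvalE _ Uly) [LHS](sf l (exist _ y Uy)).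
Qed.

Lemma homogeneousP U q (f : osheaf m U) :
  homogeneous q f <-> forall y, ghomog q (gval f y).
Proof.
split=> [fq y I Iq|fq x I Iq]; last by rewrite gval_sval fq.
have [Uy|Uy] := pselect (cone U y); last by rewrite gval_out // ffunE.
by rewrite gvalE fq.
Qed.

(** The components of a section, read off a function on the whole of
    K^(n+1). *)
Definition is_section U (F : point -> grassmann K m) : Prop := forall I,
  regular_fun U (fun y => F y I : K) /\ homog_fun U #|I| (fun y => F y I : K).

Lemma mksec_subproof U (F : point -> grassmann K m) : is_section U F ->
  (fun x : {x | cone U x} => F (sval x)) \in @structure_pred K n m U.
Proof.
move=> sF; apply/asboolP; split=> [I x|l x y l0 xy I].
  have [g [h [hx E]]] := (sF I).1 _ (svalP x); exists g, h; split=> // y hy.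
  by have [] := E _ hy.
rewrite xy; apply: (sF I).2 => //; exact: svalP.
Qed.

Definition mksec U (F : point -> grassmann K m) (sF : is_section U F) : osheaf
  m U :=
  OSheaf (mksec_subproof sF).

Lemma gval_mksec U (F : point -> grassmann K m) (sF : is_section U F) y : cone
  U y ->
  gval (mksec sF) y = F y.
Proof. by move=> Uy; rewrite gvalE. Qed.

End Sections.

(** * Derivations are determined by the affine coordinates *)

Section Derivations.
Variables (K : closedFieldType) (n m : nat).
Local Notation point := 'rV[K]_n.+1.
Local Notation PT := (popenT K n).
Implicit Types (U V W : popen K n) (x y : point) (F G : point -> K).
Implicit Types (I J : {set 'I_m}) (D : operation m PT).

Lemma subT V : subopen V PT.
Proof. by move=> y; apply: cone_neq0. Qed.

(** The value at y of D f; every inclusion V <= P^n is the one given by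
    subT. *)
Definition act D V (f : osheaf m V) : point -> grassmann K m :=
  gval (D V (@subT V) f).

Section Rules.
Variables (p : bool) (D : operation m PT).
Hypothesis HD : superderivation p D.

Lemma act_lin V c (f g : osheaf m V) y :
  act D (c *: f + g) y = c *: act D f y + act D g y.
Proof. by rewrite /act (sder_linear HD) gvalZD. Qed.

Lemma act0 V y : act D (0 : osheaf m V) y = 0.
Proof.
have := act_lin 1 (0 : osheaf m V) 0 y; rewrite scale1r addr0 scale1r => E.
by apply/(addrI (act D (0 : osheaf m V) y)); rewrite addr0 -E.
Qed.

Lemma actZ V c (f : osheaf m V) y : act D (c *: f) y = c *: act D f y.
Proof. by rewrite -[c *: f]addr0 act_lin act0 addr0. Qed.

Lemma actD V (f g : osheaf m V) y : act D (f + g) y = act D f y + act D g y.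
Proof. by rewrite -[f]scale1r act_lin !scale1r. Qed.

Lemma act_mul V q (f g : osheaf m V) y : (forall y, ghomog q (gval f y)) ->
  act D (omul f g) y = gmul (act D f y) (gval g y) +
    (-1) ^+ (p && q) *: gmul (gval f y) (act D g y).
Proof.
move=> /homogeneousP fq; rewrite /act (sder_leibniz HD _ _ fq).
by rewrite addrC gvalZD !gval_omul addrC.
Qed.

Lemma act_homog V q (f : osheaf m V) y : (forall y, ghomog q (gval f y)) ->
  ghomog (p (+) q) (act D f y).
Proof.
move=> /homogeneousP fq.
exact: (proj1 (homogeneousP _ _) (sder_parity HD (@subT V) fq) y).
Qed.

Lemma act_ores V V' (VV : subopen V' V) (f : osheaf m V) y : cone V' y ->
  act D (ores VV f) y = act D f y.
Proof.
by move=> Vy; rewrite /act -(sder_res HD (@subT V)) gval_ores.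
Qed.

(** D commutes with restriction, so (D f) y depends on f near y only. *)
Lemma act_local V V' W (f : osheaf m V) (f' : osheaf m V') y :
  subopen W V -> subopen W V' ->
  (forall y, cone W y -> gval f y = gval f' y) -> cone W y ->
  act D f y = act D f' y.
Proof.
move=> WV WV' E Wy; rewrite -(act_ores WV) // -(act_ores WV') //.
congr (act D _ y); apply: gval_inj => z Wz; rewrite !gval_ores //; exact: E.
Qed.

End Rules.

Lemma is_section_scale U d (c : grassmann K m) F :
  (forall I, c I != 0 -> #|I| = d) ->
  regular_fun U F -> homog_fun U d F -> is_section U (fun y => F y *: c).
Proof.
move=> cd rF hF I; have E : (fun y => (F y *: c) I : K) = fun y => F y * c I.
  by apply/funext => y; rewrite gscaleE.
split; rewrite E; first by apply: regular_funM rF _; apply: regular_funC.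
move=> l y l0 Uy; have [->|/cd Id] := eqVneq (c I) 0; first by rewrite !mulr0.
by rewrite Id mulrA hF.
Qed.

Definition gbasis J : grassmann K m := [ffun I : {set 'I_m} =>
  (I == J)%:R : K^o].

Lemma gbasis0 : gbasis finset.set0 = gone K m.
Proof. by []. Qed.

Lemma gbasis_deg J I : gbasis J I != 0 -> #|I| = #|J|.
Proof. by rewrite ffunE; have [->//|_] := eqVneq I J; rewrite eqxx. Qed.

Lemma gtmul_gbasis a J : a \notin J ->
  gtmul a (gbasis J) = (-1) ^+ below a J *: gbasis (a |: J).
Proof.
move=> aJ; apply/ffunP => I; rewrite gscaleE !ffunE.
have [aI|aI] := boolP (a \in I); last first.
  have [E|_] := eqVneq I (a |: J); last by rewrite mulr0.
  by rewrite E setU11 in aI.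
have -> : (I == a |: J) = (I :\ a == J).
  by apply/eqP/eqP => [->|<-]; rewrite ?setU1K ?setD1K.
by case: eqP => [<-|]; rewrite ?mulr0 // -[in LHS](setD1K aI) belowU //
  !inE eqxx.
Qed.

Lemma gbasis_sum (f : grassmann K m) : f = \sum_I (f I : K) *: gbasis I.
Proof.
apply/ffunP => J; rewrite sum_ffunE (bigD1 J) //= big1 ?addr0.
  by rewrite gscaleE ffunE eqxx mulr1.
by move=> I IJ; rewrite gscaleE ffunE eq_sym (negbTE IJ) mulr0.
Qed.

Definition stdchart (i : 'I_n.+1) : popen K n := chart PT i.
Local Notation U_ i := (stdchart i).

Lemma stdchartP i y : cone (U_ i) y <-> y 0 i != 0.
Proof.
rewrite chartP; split=> [[]//|yi]; split=> //.
by apply: contraNneq yi => ->; rewrite mxE.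
Qed.

Lemma regular_coordV i : regular_fun (U_ i) (fun y => (y 0 i)^-1).
Proof. by apply: regular_funV; [apply: regular_fun_coord | move=>
  y /stdchartP]. Qed.

Fact xsec_subproof i k : is_section (U_ i) (fun y =>
  (y 0 k / y 0 i) *: gone K m).
Proof.
apply: (@is_section_scale _ 0).
- by move=> I /gbasis_deg; rewrite cards0.
- exact: regular_funM (@regular_fun_coord _ _ _ k) (@regular_coordV i).
- move=> l y l0 /stdchartP yi; rewrite !mxE expr0 mul1r -mulf_div divff //.
  by rewrite mul1r.
Qed.
(** The affine coordinate x_k / x_i. *)
Definition xsec i k : osheaf m (U_ i) := mksec (@xsec_subproof i k).

Fact tsec_subproof i a : is_section (U_ i) (fun y =>
  (y 0 i)^-1 *: gtmul a (gone K m)).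
Proof.
apply: (@is_section_scale _ 1).
- move=> I; rewrite -gbasis0 gtmul_gbasis ?inE // gscaleE mulf_eq0 negb_or.
  by move=> /andP[_ /gbasis_deg ->]; rewrite setU0 cards1.
- exact: regular_coordV.
- move=> l y l0 /stdchartP yi; rewrite !mxE expr1 invfM mulrA divff //.
  by rewrite mul1r.
Qed.
(** The odd affine coordinate t_a / x_i. *)
Definition tsec i a : osheaf m (U_ i) := mksec (@tsec_subproof i a).

Lemma gval_xsec i k y : y 0 i != 0 ->
  gval (xsec i k) y = (y 0 k / y 0 i) *: gone K m.
Proof. by move=> /stdchartP yi; rewrite gval_mksec. Qed.

Lemma gval_tsec i a y : y 0 i != 0 ->
  gval (tsec i a) y = (y 0 i)^-1 *: gtmul a (gone K m).
Proof. by move=> /stdchartP yi; rewrite gval_mksec. Qed.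

Lemma ghomogZ q c (f : grassmann K m) : ghomog q f -> ghomog q (c *: f).
Proof. by move=> fq I Iq; rewrite gscaleE fq // mulr0. Qed.

Lemma ghomog0 q : ghomog q (0 : grassmann K m).
Proof. by move=> I _; rewrite ffunE. Qed.

Lemma xsec_even i k y : ghomog false (gval (xsec i k) y).
Proof.
have [yi|yi] := pselect (cone (U_ i) y); last by rewrite gval_out //;
  apply: ghomog0.
by rewrite gval_mksec //; apply/ghomogZ/ghomog_gone.
Qed.

Lemma tsec_odd i a y : ghomog true (gval (tsec i a) y).
Proof.
have [yi|yi] := pselect (cone (U_ i) y); last by rewrite gval_out //;
  apply: ghomog0.
by rewrite gval_mksec //; apply/ghomogZ/(ghomog_gtmul (q := false))/ghomog_gone.
Qed.

Section Uniqueness.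
Variables (p : bool) (D : operation m PT).
Hypothesis HD : superderivation p D.

(** 1 * 1 = 1 and the Leibniz rule; the section x_i / x_i is 1. *)
Lemma act_one i y : cone (U_ i) y -> act D (xsec i i) y = 0.
Proof.
move=> Uy; have E : omul (xsec i i) (xsec i i) = xsec i i.
  apply: gval_inj => z /stdchartP zi; rewrite gval_omul !gval_xsec //.
  by rewrite divff // scale1r gmul1g.
have := act_mul HD (xsec i i) y (@xsec_even i i); rewrite E.
move: (Uy) => /stdchartP yi; rewrite gval_xsec // divff //
  scale1r gmulg1 gmul1g.
rewrite andbF scale1r => /(congr1 (fun u => u - act D (xsec i i) y)).
by rewrite subrr addrK.
Qed.

Hypotheses (Dx : forall i k y, cone (U_ i) y -> act D (xsec i k) y = 0)
  (Dt : forall i a y, cone (U_ i) y -> act D (tsec i a) y = 0).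

(** The polynomials in the coordinates x_k / x_i; they are generated by
    constants and the coordinates, all of which D kills. *)
Lemma act_poly i (g : {mpoly K[n.+1]}) : exists s : osheaf m (U_ i),
  forall y, cone (U_ i) y ->
    gval s y = evalp g ((y 0 i)^-1 *: y) *: gone K m /\ act D s y = 0.
Proof.
elim/mpoly_ring_ind: g => [c|k|g h [s sE] [t tE]|g h [s sE] [t tE]].
- exists (c *: xsec i i) => y Uy; rewrite (actZ HD) act_one // scaler0;
  split=> //.
  rewrite -[c *: _]addr0 gvalZD; move/stdchartP: (Uy) => yi.
  rewrite gval_xsec // divff // evalpC scale1r.
  by rewrite (gvalE _ Uy) addr0.
- exists (xsec i k) => y Uy; rewrite Dx //; split=> //.
  move/stdchartP: (Uy) => yi.
  by rewrite gval_xsec // evalpX mxE mulrC.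
- exists (1 *: s + t) => y Uy; have [s1 s2] := sE y Uy; have [t1 t2] := tE y Uy.
  by rewrite (act_lin HD) gvalZD s1 t1 s2 t2 !scale1r addr0 evalpD scalerDl.
- exists (omul s t) => y Uy; have [s1 s2] := sE y Uy; have [t1 t2] := tE y Uy.
  have se z : ghomog false (gval s z).
    have [Uz|Uz] := pselect (cone (U_ i) z).
      by have [-> _] := sE z Uz; apply/ghomogZ/ghomog_gone.
    by rewrite gval_out //; apply: ghomog0.
  rewrite (act_mul HD (q := false)) // s2 t2 gval_omul s1 t1 evalpM.
  rewrite gmulZl gmul1g scalerA; split=> //.
  by rewrite gmul0g gmulg0 scaler0 addr0.
Qed.

(** F has weight 0, so F x = F (x / x_i), and near x / x_i it is a fraction g /
    h. Hence sh * s = sg near x for the sections sg, sh that dehomogenise g and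
    h, and the Leibniz rule gives h (x / x_i) * D s = 0 at x. *)
Lemma act_scalar V F (rF : regular_fun V F) (hF : homog_fun V 0 F)
    (s : osheaf m V) i x :
  (forall y, cone V y -> gval s y = F y *: gone K m) ->
  cone V x -> x 0 i != 0 -> act D s x = 0.
Proof.
move=> sE Vx xi.
have hF' z : cone V z -> z 0 i != 0 -> F ((z 0 i)^-1 *: z) = F z.
  by move=> Vz zi; rewrite -(hF (z 0 i)^-1 z) ?invr_neq0 // expr0 mul1r.
have Vx' : cone V ((x 0 i)^-1 *: x) by apply: cone_scale => //;
  rewrite invr_neq0.
have [g [h [hx E]]] := rF _ Vx'.
have [sg sgE] := act_poly i g; have [sh shE] := act_poly i h.
pose H y := gval sh y finset.set0 : K.
have HE y : y 0 i != 0 -> H y = evalp h ((y 0 i)^-1 *: y).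
  move=> /stdchartP yi; have [e _] := shE y yi.
  by rewrite /H e gscaleE ffunE eqxx mulr1.
have VU : subopen (chart V i) (U_ i) by move=> y [_ /stdchartP].
have rH : regular_fun (chart V i) H.
  exact: regular_fun_sub VU (gval_regular sh finset.set0).
have sH l y : l != 0 -> cone (chart V i) y -> H y != 0 -> H (l *: y) != 0.
  move=> l0 [Vy yi]; rewrite !HE //; last by rewrite mxE mulf_neq0.
  by rewrite mxE invfM scalerA mulrAC mulVf // mul1r.
pose V' := nonvanishing rH sH.
have V'V : subopen V' V by move=> y [[]].
have V'U : subopen V' (U_ i) by move=> y [/VU].
have V'x : cone V' x by split; rewrite ?HE.
have xU := V'U _ V'x.
have eq1 : omul (ores V'U sh) (ores V'V s) = ores V'U sg.
  apply: gval_inj => y V'y; rewrite gval_omul !gval_ores //.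
  have [[Vy yi] Hy] := V'y; have Uy := V'U _ V'y.
  have [-> _] := shE y Uy; have [-> _] := sgE y Uy; rewrite sE //.
  rewrite gmulZl gmul1g scalerA -hF' //.
  rewrite HE // in Hy; have [_ ->] := E _ Hy.
  by rewrite mulrC divfK.
have ev y : ghomog false (gval (ores V'U sh) y).
  have [V'y|V'y] := pselect (cone V' y); last by rewrite gval_out //;
    apply: ghomog0.
  have [e _] := shE y (V'U _ V'y); rewrite gval_ores // e.
  exact/ghomogZ/ghomog_gone.
have := act_mul HD (ores V'V s) x ev.
rewrite eq1 !(act_ores HD) // !gval_ores //.
have [-> ->] := shE x xU; have [_ ->] := sgE x xU.
rewrite andbF scale1r gmulZl gmul1g gmul0g add0r => /esym/eqP.
by rewrite scaler_eq0 (negbTE hx) => /eqP.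
Qed.

(** Up to sign t_J / x_i ^ #|J| is a product of the odd coordinates t_a /
    x_i. *)
Lemma act_tbasis i J : exists s : osheaf m (U_ i), forall y, cone (U_ i) y ->
  gval s y = (y 0 i) ^- #|J| *: gbasis J /\ act D s y = 0.
Proof.
have [d] := ubnP #|J|; elim: d J => // d IH J Jd.
have [->|[a aJ]] := set_0Vmem J.
  exists (xsec i i) => y Uy; rewrite act_one //; split=> //.
  move/stdchartP: Uy => yi.
  by rewrite gval_xsec // divff // gbasis0 cards0 expr0 invr1.
have Jc : #|J| = #|J :\ a|.+1 by rewrite (cardsD1 a J) aJ.
have [|s sE] := IH (J :\ a); first by rewrite -ltnS -Jc.
have aD : a \notin J :\ a by rewrite !inE eqxx.
exists ((-1) ^+ below a (J :\ a) *: omul (tsec i a) s) => y Uy.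
have [s1 s2] := sE y Uy; rewrite (actZ HD) (act_mul HD (q := true)) ?s2 ?Dt //;
  last first.
  by move=> z; apply: tsec_odd.
split; last first.
  by rewrite gmul0g gmulg0 !scaler0 addr0 scaler0.
rewrite -[_ *: omul _ _]addr0 gvalZD gval_omul s1.
move/stdchartP: (Uy) => yi; rewrite gval_tsec // gmulZl gmulZr -gtmul_gmull
  gmul1g.
rewrite gtmul_gbasis // setD1K // (gvalE _ Uy) addr0 !scalerA; congr (_ *: _).
rewrite Jc exprS invfM [_ * (-1) ^+ _]mulrC !mulrA -expr2 sqrr_sign mul1r.
by [].
Qed.

Lemma gval0 V y : gval (0 : osheaf m V) y = 0.
Proof.
have [Vy|Vy] := pselect (cone V y); last by rewrite gval_out.
by rewrite (gvalE _ Vy).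
Qed.

Lemma gvalD V (f g : osheaf m V) y : gval (f + g) y = gval f y + gval g y.
Proof. by rewrite -[f]scale1r gvalZD !scale1r. Qed.

(** A derivation is determined by its values on the affine coordinates: on the
    chart, f is the sum of the products (f_J * x_i ^ #|J|) * (t_J / x_i ^
    #|J|). *)
Lemma derivation_eq0 V (f : osheaf m V) x : cone V x -> act D f x = 0.
Proof.
move=> Vx; have /rV0Pn[i xi] := cone_neq0 Vx.
have cx : cone (chart V i) x by [].
have VU : subopen (chart V i) (U_ i) by move=> y [_ /stdchartP].
have [T TE] : exists T : {set 'I_m} -> osheaf m (U_ i), forall J y,
    cone (U_ i) y ->
    gval (T J) y = (y 0 i) ^- #|J| *: gbasis J /\ act D (T J) y = 0.
  by exists (fun J => sval (cid (act_tbasis i J))) => J; case: cid.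
pose F J y := (y 0 i) ^+ #|J| * (gval f y J : K).
have rF J : regular_fun (chart V i) (F J).
  apply: regular_funM; last exact: regular_fun_sub (@chart_sub _ _ V i)
    (gval_regular f J).
  elim: #|J| => [|d IH]; first exact: regular_funC.
  apply: (@regular_fun_eq _ _ _ (fun y => y 0 i * y 0 i ^+ d)).
    by move=> y _; rewrite exprS.
  by apply: regular_funM => //; apply: regular_fun_coord.
have hF J : homog_fun (chart V i) 0 (F J).
  move=> l y l0 [Vy yi]; rewrite expr0 mul1r /F mxE exprMn.
  by have /= <- := gval_homog f J l0 Vy; ring.
have sF J : is_section (chart V i) (fun y => F J y *: gone K m).
  by apply: (@is_section_scale _ 0) => // I /gbasis_deg; rewrite cards0.
pose S := \sum_J omul (mksec (sF J)) (ores VU (T J)).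
have -> : act D f x = act D S x.
  apply: (act_local HD (W := chart V i)) => //; first exact: chart_sub.
  move=> y Cy; rewrite (big_morph _ (fun f g => gvalD f g y) (gval0 _ y)).
  rewrite [LHS]gbasis_sum; apply: eq_bigr => J _.
  rewrite gval_omul gval_mksec // gval_ores //.
  have [-> _] := TE J y (VU _ Cy); rewrite gmulZl gmul1g scalerA.
  have [_ yi] := Cy.
  by rewrite /F mulrAC divff ?mul1r // expf_neq0.
rewrite (big_morph (fun s => act D s x) (fun f g =>
  actD HD f g x) (act0 HD _ x)).
apply: big1 => J _; rewrite (act_mul HD (q := false)).
  rewrite (act_ores HD) //; have [_ ->] := TE J x (VU _ cx).
  have -> : act D (mksec (sF J)) x = 0.
    by apply: (act_scalar (rF J) (hF J) (i := i)) => // y Cy;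
      rewrite gval_mksec.
  by rewrite gmul0g gmulg0 scaler0 addr0.
move=> y; have [Cy|Cy] := pselect (cone (chart V i) y).
  by rewrite gval_mksec //; apply/ghomogZ/ghomog_gone.
by rewrite gval_out //; apply: ghomog0.
Qed.

End Uniqueness.
End Derivations.

(** * Homogeneous regular functions on planes *)

Section Lines.
Variables (K : closedFieldType) (n : nat).
Local Notation point := 'rV[K]_n.+1.
Implicit Types (u v x y z : point) (F G : point -> K).

Definition line u v (g : {mpoly K[n.+1]}) : {poly K} :=
  mmap (@polyC K) (fun i => (u 0 i)%:P + v 0 i *: 'X) g.

Lemma line_eval u v g s : (line u v g).[s] = evalp g (u + s *: v).
Proof.
rewrite /line; elim/mpoly_ring_ind: g => [c|k|g h Eg Eh|g h Eg Eh].
- by rewrite mmapC hornerC evalpC.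
- by rewrite mmapX mmap1U evalpX hornerD hornerC hornerZ hornerX !mxE mulrC.
- by rewrite raddfD hornerD Eg Eh evalpD.
- by rewrite rmorphM hornerM Eg Eh evalpM.
Qed.

Lemma line_deriv u v g :
  (line u v g)^`().[0] = \sum_i v 0 i * evalp g^`M(i) u.
Proof.
have L0 f : (line u v f).[0] = evalp f u by rewrite line_eval scale0r addr0.
elim/mpoly_ring_ind: g => [c|k|g h Eg Eh|g h Eg Eh].
- rewrite /line mmapC derivC horner0 big1 // => i _.
  by rewrite mderivC -mpolyC0 evalpC mulr0.
- rewrite /line mmapX mmap1U derivD derivC derivZ derivX add0r hornerZ hornerC.
  rewrite (bigD1 k) //= big1 ?addr0 => [|i ik].
    rewrite mderivX mnmE eqxx scale1r.
    have -> : (U_(k) - U_(k))%MM = 0%MM by apply/mnmP => j; rewrite !mnmE subnn.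
    by rewrite mpolyX0 -mpolyC1 evalpC.
  by rewrite mderivX mnmE eq_sym (negbTE ik) scale0r -mpolyC0 evalpC mulr0.
- rewrite /line raddfD derivD hornerD Eg Eh -big_split; apply: eq_bigr => i _.
  by rewrite mderivD evalpD mulrDr.
- rewrite /line rmorphM derivM hornerD !hornerM Eg Eh !L0 mulr_suml mulr_sumr.
  rewrite -big_split; apply: eq_bigr => i _.
  by rewrite mderivM evalpD !evalpM /=; ring.
Qed.

Definition indep u v : Prop := forall a b, a *: u + b *: v = 0 ->
  a = 0 /\ b = 0.

Lemma indep_coord u v i k : u 0 i != 0 -> v 0 i = 0 -> v 0 k != 0 -> indep u v.
Proof.
move=> ui vi vk a b /rowP E; have := E i; rewrite !mxE vi mulr0 addr0 => /eqP.
rewrite mulf_eq0 (negbTE ui) orbF => /eqP a0; split=> //.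
have := E k; rewrite !mxE a0 mul0r add0r => /eqP.
by rewrite mulf_eq0 (negbTE vk) orbF => /eqP.
Qed.

(** F is homogeneous of degree w - d, which may be negative. *)
Definition weighted d w F : Prop := forall l y, l != 0 -> y != 0 ->
  l ^+ d * F (l *: y) = l ^+ w * F y.

Lemma regular_line F u v : regular_fun (popenT K n) F ->
  (forall s, u + s *: v != 0) -> exists p, forall s, F (u + s *: v) = p.[s].
Proof.
move=> rF uv; apply: regular_line_poly => s0.
have [g [h [hx E]]] := rF (u + s0 *: v) (uv s0);
  exists (line u v g), (line u v h).
rewrite line_eval; split=> // s; rewrite !line_eval => hs.
by have [] := E _ hs.
Qed.

(** A line in the plane of u and v that avoids the origin carries a polynomial;
    homogeneity bounds its degree. *)
Lemma weighted_line d w F u v : regular_fun (popenT K n) F -> weighted d w F ->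
  indep u v -> exists p, [/\ forall s, F (u + s *: v) = p.[s],
    (size p <= w.+1 - d)%N & (d <= w)%N -> p`_(w - d) = F v].
Proof.
move=> rF hF iuv.
have uv s : u + s *: v != 0.
  apply/eqP => E; have [|/eqP] := iuv 1 s; first by rewrite scale1r.
  by rewrite oner_eq0.
have vu s : v + s *: u != 0.
  apply/eqP => E; have [|_ /eqP] := iuv s 1; first by rewrite scale1r addrC.
  by rewrite oner_eq0.
have [p pE] := regular_line rF uv; have [q qE] := regular_line rF vu.
have H s : s != 0 -> s ^+ d * p.[s] = s ^+ w * q.[s^-1].
  move=> s0; rewrite -pE -qE -hF //; congr (_ * F _).
  by rewrite scalerDr scalerA divff // scale1r addrC.
have [sp lp] := poly_homog_size H; exists p; split=> // dw.
by rewrite lp // -qE scale0r addr0.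
Qed.

Definition base (i : 'I_n.+1) : point := delta_mx 0 i.
Lemma baseE i j : base i 0 j = (j == i)%:R.
Proof. by rewrite mxE eqxx. Qed.

Lemma base_neq0 i : base i != 0.
Proof. by apply/eqP => /rowP/(_ i); rewrite baseE mxE eqxx => /eqP;
  rewrite oner_eq0. Qed.

(** The polynomial on a line through y has size at most w.+1 - d = 0. *)
Lemma weighted_gt d w F : (0 < n)%N -> (w < d)%N ->
  regular_fun (popenT K n) F -> weighted d w F -> forall y, y != 0 -> F y = 0.
Proof.
move=> n0 wd rF hF y /rV0Pn[i yi].
have [j ji] : exists j : 'I_n.+1, j != i.
  case: (eqVneq i ord0) => [->|i0]; last by exists ord0; rewrite eq_sym.
  by exists ord_max; rewrite -val_eqE /= -lt0n.
have iyv : indep y (base j).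
  apply: (@indep_coord _ _ i j); rewrite ?baseE ?eqxx ?oner_eq0 //.
  by rewrite eq_sym (negbTE ji).
have [p [pE sp _]] := weighted_line rF hF iyv.
have := pE 0; rewrite scale0r addr0 => ->.
have -> : p = 0 by apply/eqP; rewrite -size_poly_leq0; apply: leq_trans sp _;
  lia.
by rewrite horner0.
Qed.

(** Compare u and v along a line if they are independent, along a ray if
    not. *)
Lemma weighted_const d F u v : regular_fun (popenT K n) F -> weighted d d F ->
  u != 0 -> v != 0 -> F u = F v.
Proof.
move=> rF hF u0 v0; have ind x y : indep x y -> F x = F y.
  move=> /(weighted_line rF hF)[p [pE sp lp]].
  rewrite -lp // subnn -[x]addr0 -(scale0r y) pE.
  have /size1_polyC -> : (size p <= 1)%N by apply: leq_trans sp _; lia.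
  by rewrite hornerC coefC.
have scal (c : K) x : c != 0 -> x != 0 -> F (c *: x) = F x.
  by move=> c0 x0; apply: (mulfI (expf_neq0 d c0)); apply: hF.
have [/ind//|nind] := pselect (indep u v).
have [c [c0 ->]] : exists c, c != 0 /\ u = c *: v; last exact: scal.
have [a [b [E ab]]] : exists a b, a *: u + b *: v = 0 /\ (a != 0) || (b != 0).
  apply: contra_notP nind => H a b E; have [a0|a0] := eqVneq a 0.
    have [b0|b0] := eqVneq b 0; first by [].
    by case: H; exists a, b; rewrite b0 orbT.
  by case: H; exists a, b; rewrite a0.
have a0 : a != 0.
  apply: contraTneq ab => a0; move: E; rewrite a0 scale0r add0r => /eqP.
  by rewrite scaler_eq0 (negbTE v0) orbF => /eqP ->; rewrite eqxx.
have uE : u = (- (a^-1 * b)) *: v.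
  rewrite scaleNr -scalerA -[LHS](scalerK a0) -scalerN; congr (_ *: _).
  by apply/eqP; rewrite -addr_eq0 E.
exists (- (a^-1 * b)); split=> //; apply: contraNneq u0 => c0.
by rewrite uE c0 scale0r.
Qed.

Lemma weighted_affine d F u v : regular_fun (popenT K n) F ->
  weighted d d.+1 F -> indep u v -> F (u + v) = F u + F v.
Proof.
move=> rF hF /(weighted_line rF hF)[p [pE sp lp]].
rewrite -lp // subSnn -[v]scale1r pE -[X in _ = F X + _]addr0 -(scale0r v) pE.
rewrite !(horner_coef_wide _ (_ : size p <= 2)%N); first last.
- by apply: leq_trans sp _; lia.
- by apply: leq_trans sp _; lia.
by rewrite !big_ord_recr !big_ord0 /= !expr0 !expr1 !mulr1 mulr0 !add0r addr0.
Qed.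

(** A binary quadratic form that vanishes at u and v is a multiple of their
    product. *)
Lemma weighted_quad d F u v : regular_fun (popenT K n) F ->
  weighted d d.+2 F -> indep u v -> F u = 0 -> F v = 0 ->
  forall s, F (u + s *: v) = s * F (u + v).
Proof.
move=> rF hF /(weighted_line rF hF)[p [pE sp lp]] Fu Fv s.
rewrite -[v in RHS]scale1r !pE.
have sp3 : (size p <= 3)%N by apply: leq_trans sp _; lia.
have p2 : p`_2 = 0.
  have E : 2%N = (d.+2 - d)%N by lia.
  by rewrite -[RHS]Fv E; apply: lp; lia.
have p0 : p`_0 = 0.
  by rewrite -[RHS]Fu -[u in RHS]addr0 -(scale0r v) pE horner_coef0.
rewrite !(horner_coef_wide _ sp3) !big_ord_recr !big_ord0 /= p0 p2.
by rewrite !expr1 !(mul0r, add0r, addr0, mulr1) mulrC.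
Qed.

Definition supp z : {set 'I_n.+1} := [set i | z 0 i != 0].

Lemma supp1 z k : (forall j, j != k -> z 0 j = 0) -> z = z 0 k *: base k.
Proof.
move=> H; apply/rowP => j; rewrite !mxE eqxx /=.
by have [->|/H ->] := eqVneq j k; rewrite ?mulr1 ?mulr0.
Qed.

Lemma weighted_scale0 d w F z c : weighted d w F -> z != 0 -> F z = 0 ->
  c != 0 -> F (c *: z) = 0.
Proof.
move=> hF z0 Fz c0; apply: (mulfI (expf_neq0 d c0)).
by rewrite hF // Fz !mulr0.
Qed.

(** F is additive on independent vectors: remove one coordinate of z at a
    time. *)
Lemma weighted_linear0 d F : regular_fun (popenT K n) F ->
  weighted d d.+1 F -> (forall j, F (base j) = 0) ->
  forall z, z != 0 -> F z = 0.
Proof.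
move=> rF hF F0 z; have [c] := ubnP #|supp z|; elim: c z => // c IH z zc z0.
have /rV0Pn[k zk] := z0; have [/existsP[l /andP[lk zl]]|] :=
  boolP [exists l, (l != k) && (z 0 l != 0)]; last first.
  rewrite negb_exists => /forallP H; rewrite (@supp1 z k) => [|j jk].
    by apply: weighted_scale0 hF _ _ zk; rewrite ?base_neq0.
  by have := H j; rewrite jk negbK => /eqP.
pose w := z 0 k *: base k; pose u := z - w.
have wE j : w 0 j = if j == k then z 0 k else 0.
  by rewrite mxE baseE; case: eqP; rewrite ?mulr1 ?mulr0.
have uE j : u 0 j = if j == k then 0 else z 0 j.
  by rewrite mxE [(- w) 0 j]mxE wE; case: eqP => [->|]; rewrite ?subrr ?subr0.
have -> : z = u + w by rewrite subrK.
rewrite (weighted_affine rF hF); last first.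
  by apply: (@indep_coord _ _ l k); rewrite ?wE ?uE ?(negbTE lk) ?eqxx.
rewrite (weighted_scale0 hF (base_neq0 k)) // addr0; apply: IH.
  rewrite -ltnS; apply: leq_trans zc; rewrite ltnS; apply: proper_card.
  apply/properP; split; last by exists k; rewrite !inE ?uE ?eqxx.
  by apply/subsetP => j; rewrite !inE uE; case: (j == k); rewrite ?eqxx.
by apply/rV0Pn; exists l; rewrite uE (negbTE lk).
Qed.

End Lines.

(** * Vector fields as bivectors *)

Section Bivectors.
Variables (K : closedFieldType) (n d : nat).
Local Notation point := 'rV[K]_n.+1.
Local Notation base := (@base K n).
Variable F : 'I_n.+1 -> 'I_n.+1 -> point -> K.
Hypotheses (rF : forall j k, regular_fun (popenT K n) (F j k))
  (hF : forall j k, weighted d 2 (F j k))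
  (antiF : forall j k (y : point), F j k y = - F k j y)
  (diagF : forall j (y : point), F j j y = 0)
  (cocF : forall j k l (y : point),
    y 0 l * F j k y + y 0 j * F k l y + y 0 k * F l j y = 0).

(** At the point e_l only the components (l, k) and (j, l) can be non-zero. *)
Lemma bivector_base0 : (forall j k, F j k (base j) = 0) ->
  forall l j k, F j k (base l) = 0.
Proof.
move=> F0 l j k; have [<-|jl] := eqVneq j l; first exact: F0.
have [<-|kl] := eqVneq k l; first by rewrite antiF F0 oppr0.
have := cocF j k l (base l); rewrite !baseE eqxx (negbTE jl) (negbTE kl).
by rewrite mul1r !mul0r !addr0.
Qed.

(** The relation cocF says that x ^ F(x) = 0, so F(x) = x ^ A(x) is a vector
    field on projective space. If it vanishes at u and v then it is tangent to
    the line through them: F (u + s v) = s F (u + v), and x ^ F(x) = 0 along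
    the line is a polynomial identity in s, whose coefficients are the two
    equations. *)
Lemma bivector_tangent u v : d = 0%N -> indep u v -> (forall j k,
  F j k u = 0) ->
  (forall j k, F j k v = 0) -> forall j k l,
  let b := fun j k => F j k (u + v) in
  u 0 l * b j k + u 0 j * b k l + u 0 k * b l j = 0 /\
  v 0 l * b j k + v 0 j * b k l + v 0 k * b l j = 0.
Proof.
move=> d0 iuv Fu Fv j k l b.
have q a c s : F a c (u + s *: v) = s * b a c.
  have hF0 : weighted 0 2 (F a c) by have := hF a c; rewrite d0.
  exact: (weighted_quad (rF a c) hF0).
set A := (X in X = 0 /\ _); set B := (X in _ /\ X = 0).
have E s : s * (A + s * B) = 0.
  by have := cocF j k l (u + s *: v); rewrite !q !mxE /A /B => <-; ring.
have : A *: 'X + B *: 'X^2 = 0 :> {poly K}.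
  apply: (@poly_eq_off _ _ _ 1) => [|s _]; first exact: oner_neq0.
  by rewrite hornerD !hornerZ hornerXn hornerX horner0 -[RHS](E s); ring.
move=> /polyP H; have := H 1%N; have := H 2%N.
by rewrite !coefD !coefZ !coefX !coefXn !coef0 /= !mulr0 !mulr1 add0r addr0.
Qed.

(** A vector field on projective space that vanishes at the points e_j and e_0
    + e_k vanishes, by induction on the support of z outside of the index 0. If
    z has at least two such indices k and l, then for every scalar a it lies on
    the line through z - w and w = z_k e_k - a e_0, where the field vanishes by
    induction; being tangent to two of these lines (a = 0 and a = 1), it is 0
    at z. *)
Lemma bivector_quadratic0 : d = 0%N ->
  (forall j k, F j k (base j) = 0) ->
  (forall k, F ord0 k (base ord0 + base k) = 0) ->
  forall z, z != 0 -> forall j k, F j k z = 0.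
Proof.
move=> d0 F0 F1.
have Fb := bivector_base0 F0.
have Fs c l j k : c != 0 -> F j k (c *: base l) = 0.
  by move=> c0; apply: (weighted_scale0 (hF j k) (base_neq0 K _) (Fb _ _ _) c0).
(* A bivector killed by e_0 and e_k has at most the components (0, k), (k,
   0). *)
have only0k (b : 'I_n.+1 -> 'I_n.+1 -> K) k : k != ord0 ->
    (forall j l, b j l = - b l j) -> (forall j, b j j = 0) ->
    (forall j l, j != ord0 -> l != ord0 -> b j l = 0) ->
    (forall j l, j != k -> l != k -> b j l = 0) -> b ord0 k = 0 ->
    forall j l, b j l = 0.
  move=> k0 ab db b0 bk b0k j l.
  have [j0|j0] := eqVneq j ord0; last first.
    have [l0|l0] := eqVneq l ord0; last exact: b0.
    have [jk|jk] := eqVneq j k; first by rewrite jk l0 ab b0k oppr0.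
    by apply: bk; rewrite ?l0 // eq_sym.
  have [l0|l0] := eqVneq l ord0; first by rewrite j0 l0 db.
  have [lk|lk] := eqVneq l k; first by rewrite j0 lk b0k.
  by apply: bk; rewrite // j0 eq_sym.
move=> z; have [c] := ubnP #|supp z :\ ord0|; elim: c z => // c IH z zc z0.
have [S0|[k]] := set_0Vmem (supp z :\ ord0).
  have zE : z = z 0 ord0 *: base ord0.
    apply: supp1 => j j0; apply/eqP/negP => /negP zj.
    by have := finset.in_set0 j; rewrite -S0 !inE j0 zj.
  move=> j k; rewrite zE; apply: Fs; apply: contraNneq z0 => E.
  by rewrite zE E scale0r.
rewrite !inE => /andP[k0 zk]; have k0' : (ord0 == k) = false by rewrite eq_sym
  (negbTE k0).
have [/existsP[l /and3P[lk l0 zl]]|] :=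
  boolP [exists l, [&& l != k, l != ord0 & z 0 l != 0]]; last first.
  rewrite negb_exists => /forallP H.
  have zj j : j != k -> j != ord0 -> z 0 j = 0.
    by move=> jk j0; have := H j; rewrite jk j0 negbK => /eqP.
  have zE : z = z 0 ord0 *: base ord0 + z 0 k *: base k.
    apply/rowP => j; rewrite !mxE !eqxx /=.
    have [->|jk] := eqVneq j k; first by rewrite (negbTE k0) mulr0 mulr1 add0r.
    have [->|j0] := eqVneq j ord0; first by rewrite mulr1 mulr0 addr0.
    by rewrite zj // !mulr0 addr0.
  have [a0|a0] := eqVneq (z 0 ord0) 0.
    by move=> j l; rewrite zE a0 scale0r add0r Fs.
  have i1 : indep (z 0 ord0 *: base ord0) (z 0 k *: base k).
    by apply: (@indep_coord _ _ _ _ ord0 k);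
      rewrite mxE baseE ?eqxx ?k0' ?mulr1 ?mulr0.
  have T := bivector_tangent d0 i1 (fun j l => Fs _ _ j l a0) (fun j l =>
    Fs _ _ j l zk).
  apply: (only0k (fun j l => F j l z) k) => //.
  - move=> j l j0 l0; have [/eqP + _] := T j l ord0.
    rewrite -zE ![(_ *: base ord0) 0 _]mxE !baseE eqxx (negbTE j0) (negbTE l0).
    by rewrite !mulr0 !mul0r !addr0 mulr1 mulf_eq0 (negbTE a0) => /eqP.
  - move=> j l jk lk; have [_ /eqP] := T j l k.
    rewrite -zE ![(_ *: base k) 0 _]mxE !baseE eqxx (negbTE jk) (negbTE lk).
    by rewrite !mulr0 !mul0r !addr0 mulr1 mulf_eq0 (negbTE zk) => /eqP.
  - rewrite zE -[z 0 k](divfK a0) mulrC -scalerA -scalerDr.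
    apply: weighted_scale0 (hF _ _) _ _ a0.
      apply/rV0Pn; exists ord0; rewrite !mxE !eqxx /= k0' mulr0.
      by rewrite addr0 oner_eq0.
    have i2 : indep (base ord0) (base k).
      by apply: (@indep_coord _ _ _ _ ord0 k);
        rewrite baseE ?eqxx ?oner_eq0 ?k0'.
    have hF0 : weighted 0 2 (F ord0 k) by have := hF ord0 k; rewrite d0.
    by rewrite (weighted_quad (rF _ _) hF0 i2) ?F1 ?mulr0.
pose w a := z 0 k *: base k - a *: base ord0; pose u a := z - w a.
have wE a j : w a 0 j = (if j == k then z 0 k else 0) - (if j == ord0 then a
  else 0).
  rewrite !mxE !eqxx /=.
  by case: (j == k); case: (j == ord0); rewrite ?mulr1 ?mulr0.
have uE a j : u a 0 j = (if j == k then 0 else z 0 j) + (if j == ord0 then a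
  else 0).
  rewrite mxE [(- w a) 0 j]mxE wE opprB addrCA addrC; congr (_ + _).
  by case: (eqVneq j k) => [->|]; rewrite ?subrr ?subr0.
have zE a : z = u a + w a by rewrite subrK.
have T a : forall j l i,
    u a 0 i * F j l z + u a 0 j * F l i z + u a 0 l * F i j z = 0 /\
    w a 0 i * F j l z + w a 0 j * F l i z + w a 0 l * F i j z = 0.
  have ul : u a 0 l != 0 by rewrite uE (negbTE lk) (negbTE l0) addr0.
  have wl : w a 0 l = 0 by rewrite wE (negbTE lk) (negbTE l0) subr0.
  have wk : w a 0 k != 0 by rewrite wE eqxx (negbTE k0) subr0.
  move=> j i e; rewrite (zE a).
  apply: bivector_tangent => //; first exact: indep_coord ul wl wk.
  - apply: IH; last by apply/rV0Pn; exists l.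
    rewrite -ltnS; apply: leq_trans zc; rewrite ltnS; apply: proper_card.
    apply/properP; split; last by exists k; rewrite !inE ?uE ?eqxx ?(negbTE k0)
      ?addr0 ?eqxx.
    apply/subsetP => f; rewrite !inE uE; case: (eqVneq f ord0) => //= _.
    by rewrite addr0; case: (f == k); rewrite ?eqxx.
  - apply: IH; last by apply/rV0Pn; exists k.
    rewrite -ltnS; apply: leq_trans zc; rewrite ltnS; apply: proper_card.
    apply/properP; split; last by exists l; rewrite !inE ?wl ?eqxx ?andbF ?l0.
    apply/subsetP => f; rewrite !inE wE; case: (eqVneq f ord0) => //= _.
    by rewrite subr0; case: (eqVneq f k) => [->|]; rewrite ?eqxx.
have Tw j i e := (T 0 j i e).2.
have Te j i e : base ord0 0 e * F j i z + base ord0 0 j * F i e z + base ord0 0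
  i * F e j z = 0.
  have E f : base ord0 0 f = w 0 0 f - w 1 0 f by rewrite !mxE; ring.
  rewrite !E; have H0 := Tw j i e; have H1 := (T 1 j i e).2.
  transitivity ((w 0 0 e * F j i z + w 0 0 j * F i e z + w 0 0 i * F e j z) -
    (w 1 0 e * F j i z + w 1 0 j * F i e z + w 1 0 i * F e j z)); first by ring.
  by rewrite H0 H1 subrr.
have b0 j i : j != ord0 -> i != ord0 -> F j i z = 0.
  move=> j0 i0; have := Te j i ord0.
  by rewrite !baseE eqxx (negbTE j0) (negbTE i0) mul1r !mul0r !addr0.
have wj j : w 0 0 j = if j == k then z 0 k else 0.
  by rewrite wE; case: (j == ord0); rewrite ?subr0.
apply: (only0k (fun j l => F j l z) k) => //.
- move=> j i jk ik; have /eqP := Tw j i k.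
  rewrite !wj eqxx (negbTE jk) (negbTE ik) !mul0r !addr0 mulf_eq0 (negbTE zk).
  by move=> /eqP.
- have /eqP := (T 0 ord0 k l).1; rewrite (b0 k l) //
  !uE eqxx (negbTE lk) (negbTE l0).
  rewrite eqxx (negbTE k0) mulr0 !addr0 mul0r addr0 mulf_eq0 (negbTE zl).
  by move=> /eqP.
Qed.

Lemma third_index (j k : 'I_n.+1) : (2 <= n)%N -> exists l, l != j /\ l != k.
Proof.
move=> n2; have : (0 < #|~: [set j; k]|)%N.
  have := cardsC [set j; k]; rewrite card_ord cards2.
  by case: (j != k) => /=; lia.
by move=> /card_gt0P[l]; rewrite !inE negb_or => /andP[lj lk]; exists l.
Qed.

(** The expected solution is F_jk = x_j b_k - x_k b_j, and b_k is the value of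
    F_jk at e_j for each j != k; the cocycle relation at e_j + e_l shows that
    these values agree. *)
Lemma bivector_linear0 o : d = 1%N -> o != ord0 ->
  F o ord0 (base o) = 0 -> (forall k, k != ord0 -> F ord0 k (base ord0) = 0) ->
  forall j k z, z != 0 -> F j k z = 0.
Proof.
move=> d1 o0 Fo F0.
have E j l k : j != l -> j != k -> l != k -> F j k (base j) = F l k (base l).
  move=> jl jk lk; have jlv : indep (base j) (base l).
    by apply: (@indep_coord _ _ _ _ j l); rewrite baseE ?eqxx ?oner_eq0 //
      (negbTE jl).
  have := cocF j k l (base j + base l).
  have add a b : F a b (base j + base l) = F a b (base j) + F a b (base l).
    have hF1 : weighted 1 2 (F a b) by have := hF a b; rewrite d1.
    exact: (weighted_affine (rF a b) hF1).
  have far e a b : a != e -> b != e -> F a b (base e) = 0.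
    move=> ae be; have := cocF a b e (base e).
    by rewrite !baseE eqxx (negbTE ae) (negbTE be) mul1r !mul0r !addr0.
  rewrite !mxE !eqxx /= !add [k == j]eq_sym (negbTE jk) [k == l]eq_sym (negbTE
    lk).
  rewrite eq_sym (negbTE jl) add0r addr0 !mul1r addr0 mul0r addr0.
  rewrite (far l j k) // ?(far j k l) // 1?eq_sym // addr0 add0r.
  by move=> /eqP; rewrite addr_eq0 (antiF k l) opprK => /eqP.
have Fb j k : F j k (base j) = 0.
  have [->|jk] := eqVneq j k; first exact: diagF.
  have [k0|k0] := eqVneq k ord0.
    rewrite k0 in jk *; have [->//|jo] := eqVneq j o.
    by rewrite (E j o).
  have [->|j0] := eqVneq j ord0; first exact: F0.
  by rewrite (E j ord0) ?F0 // eq_sym.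
move=> j k z z0; have hF1 : weighted 1 2 (F j k) by have := hF j k; rewrite d1.
by apply: (weighted_linear0 (rF j k) hF1) => // l; apply: bivector_base0.
Qed.

(** The cocycle relation at e_l, for an index l other than j and k; for n = 1
    there is none, and then the first cohomology of O(-2) is not zero. *)
Lemma bivector_const0 : (2 <= n)%N -> d = 2%N -> forall j k z,
  z != 0 -> F j k z = 0.
Proof.
move=> n2 d2 j k z z0; have [l [lj lk]] := third_index j k n2.
have hF2 : weighted 2 2 (F j k) by have := hF j k; rewrite d2.
rewrite (weighted_const (rF j k) hF2 z0 (base_neq0 K l)).
have := cocF j k l (base l).
by rewrite !baseE eqxx [j == l]eq_sym [k == l]eq_sym (negbTE lj) (negbTE lk)
  mul1r !mul0r !addr0.
Qed.

End Bivectors.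

(** * Rigidity of global derivations *)

Section Rigidity.
Variables (K : closedFieldType) (n m : nat).
Local Notation point := 'rV[K]_n.+1.
Local Notation PT := (popenT K n).
Local Notation base := (@base K n).
Implicit Types (I : {set 'I_m}) (D : operation m PT) (y : point).

(** The coefficients of t_I in D (x_k / x_i) and in D (t_a / x_i). *)
Definition xcomp D i k I y : K := act D (xsec K m i k) y I.
Definition tcomp D i a I y : K := act D (tsec K i a) y I.

Variables (p : bool) (D : operation m PT).
Hypothesis HD : superderivation p D.

Lemma overlap_subl (i l : 'I_n.+1) : subopen (chart (stdchart K i) l) (stdchart
  K l).
Proof. by move=> y [_ /stdchartP]. Qed.

Lemma overlapP (i l : 'I_n.+1) y : y 0 i != 0 -> y 0 l != 0 ->
  cone (chart (stdchart K i) l) y.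
Proof. by move=> /stdchartP yi yl; split. Qed.

(** The Leibniz rule for x_k / x_i = (x_k / x_l) * (x_l / x_i). *)
Lemma xcomp_change i l k I y : y 0 i != 0 -> y 0 l != 0 ->
  xcomp D i k I y = xcomp D l k I y * (y 0 l / y 0 i) +
    (y 0 k / y 0 l) * xcomp D i l I y.
Proof.
move=> yi yl; have Cy := overlapP yi yl.
have Si := @chart_sub _ _ (stdchart K i) l; have Sl := @overlap_subl i l.
have E : omul (ores Sl (xsec K m l k)) (ores Si (xsec K m i l)) =
    ores Si (xsec K m i k).
  apply: gval_inj => z Cz; have [/stdchartP zi zl] := Cz.
  rewrite gval_omul !gval_ores // !gval_xsec // gmulZl gmul1g scalerA.
  by rewrite mulrA divfK.
have ev z : ghomog false (gval (ores Sl (xsec K m l k)) z).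
  have [Cz|Cz] := pselect (cone (chart (stdchart K i) l) z).
    by rewrite gval_ores //; apply: xsec_even.
  by rewrite gval_out //; apply: ghomog0.
have := act_mul HD (ores Si (xsec K m i l)) y ev; rewrite E !(act_ores HD) //.
rewrite !gval_ores // !gval_xsec // andbF scale1r gmulZl gmulZr gmul1g gmulg1.
move=> /(congr1 (fun f : grassmann K m => f I)).
by rewrite /xcomp /= => ->; rewrite gaddE !gscaleE mulrC.
Qed.

(** The Leibniz rule for t_a / x_i = (t_a / x_l) * (x_l / x_i). *)
Lemma tcomp_change i l a I y : y 0 i != 0 -> y 0 l != 0 ->
  (forall I, xcomp D i l I y = 0) ->
  tcomp D i a I y = tcomp D l a I y * (y 0 l / y 0 i).
Proof.
move=> yi yl x0; have Cy := overlapP yi yl.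
have Si := @chart_sub _ _ (stdchart K i) l; have Sl := @overlap_subl i l.
have E : omul (ores Sl (tsec K l a)) (ores Si (xsec K m i l)) =
    ores Si (tsec K i a).
  apply: gval_inj => z Cz; have [/stdchartP zi zl] := Cz.
  rewrite gval_omul !gval_ores // gval_xsec // !gval_tsec //
    gmulZl gmulZr gmulg1.
  by rewrite scalerA mulrA mulVf // mul1r.
have od z : ghomog true (gval (ores Sl (tsec K l a)) z).
  have [Cz|Cz] := pselect (cone (chart (stdchart K i) l) z).
    by rewrite gval_ores //; apply: tsec_odd.
  by rewrite gval_out //; apply: ghomog0.
have := act_mul HD (ores Si (xsec K m i l)) y od; rewrite E !(act_ores HD) //.
have -> : act D (xsec K m i l) y = 0 by apply/ffunP => J; rewrite ffunE;
  apply: x0.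
rewrite !gval_ores // !gval_xsec // gmulg0 scaler0 addr0 gmulZr gmulg1.
move=> /(congr1 (fun f : grassmann K m => f I)).
by rewrite /tcomp /= => ->; rewrite gscaleE mulrC.
Qed.

Lemma xcomp_diag i I y : y 0 i != 0 -> xcomp D i i I y = 0.
Proof. by move=> /stdchartP yi; rewrite /xcomp (act_one HD) // ffunE. Qed.

Lemma xcomp_homog i k I l y : l != 0 -> y 0 i != 0 ->
  l ^+ #|I| * xcomp D i k I (l *: y) = xcomp D i k I y.
Proof. by move=> l0 /stdchartP yi; apply: (gval_homog _ I). Qed.

Lemma tcomp_homog i a I l y : l != 0 -> y 0 i != 0 ->
  l ^+ #|I| * tcomp D i a I (l *: y) = tcomp D i a I y.
Proof. by move=> l0 /stdchartP yi; apply: (gval_homog _ I). Qed.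

(** A lift A of D to the cone over a chart is unique up to a multiple of the
    Euler field x, so the components of x ^ A are defined on the whole cone. On
    the chart x_i != 0 one lift is A_k = x_i * D (x_k / x_i). *)
Definition bivector j k I y : K :=
  if [pick i | y 0 i != 0] is Some i then
    y 0 i * (y 0 j * xcomp D i k I y - y 0 k * xcomp D i j I y)
  else 0.

Lemma bivectorE i j k I y : y 0 i != 0 -> bivector j k I y =
  y 0 i * (y 0 j * xcomp D i k I y - y 0 k * xcomp D i j I y).
Proof.
move=> yi; rewrite /bivector; case: pickP => [l yl|/(_ i)]; last by rewrite yi.
rewrite (xcomp_change k I yi yl) (xcomp_change j I yi yl).
by field; rewrite yi yl.
Qed.

Lemma bivector_origin j k I y : (forall i, y 0 i = 0) -> bivector j k I y = 0.
Proof. by move=> y0; rewrite /bivector; case: pickP => // i;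
  rewrite y0 eqxx. Qed.

Lemma coord_cases y : (forall i, y 0 i = 0) \/ exists i, y 0 i != 0.
Proof.
have [->|/rV0Pn[i yi]] := eqVneq y 0; last by right; exists i.
by left=> i; rewrite mxE.
Qed.

Lemma bivector_regular j k I : regular_fun PT (bivector j k I).
Proof.
move=> x x0; have /rV0Pn[i xi] := x0.
have Ux : cone (stdchart K i) x by apply/stdchartP.
pose G y := y 0 i * (y 0 j * xcomp D i k I y + (- 1) * (y 0 k * xcomp D i j I
  y)).
have rG : regular_fun (stdchart K i) G.
  apply: regular_funM; first exact: regular_fun_coord.
  apply: regular_funD.
    by apply: regular_funM; [apply: regular_fun_coord | apply: gval_regular].
  apply: regular_funM; first exact: regular_funC.
  by apply: regular_funM; [apply: regular_fun_coord | apply: gval_regular].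
have [g [h [hx E]]] := rG x Ux; exists g, h; split=> // y hy.
have [Uy Gy] := E y hy; split; first exact: cone_neq0 Uy.
by move/stdchartP: Uy => yi; rewrite (bivectorE _ _ _ yi) -Gy /G mulN1r.
Qed.

Lemma bivector_weighted j k I : weighted #|I| 2 (bivector j k I).
Proof.
move=> l y l0 /rV0Pn[i yi].
have lyi : (l *: y) 0 i != 0 by rewrite mxE mulf_neq0.
rewrite (bivectorE _ _ _ yi) (bivectorE _ _ _ lyi).
rewrite -(xcomp_homog k I l0 yi) -(xcomp_homog j I l0 yi) !mxE.
by ring.
Qed.

Lemma bivector_anti j k I y : bivector j k I y = - bivector k j I y.
Proof.
have [y0|[i yi]] := coord_cases y; first by rewrite !bivector_origin ?oppr0.
by rewrite !(bivectorE _ _ _ yi); ring.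
Qed.

Lemma bivector_diag j I y : bivector j j I y = 0.
Proof.
have [y0|[i yi]] := coord_cases y; first by rewrite !bivector_origin.
by rewrite !(bivectorE _ _ _ yi); ring.
Qed.

Lemma bivector_cocycle I j k l y : y 0 l * bivector j k I y +
  y 0 j * bivector k l I y + y 0 k * bivector l j I y = 0.
Proof.
have [y0|[i yi]] := coord_cases y; first by rewrite !bivector_origin ?mulr0
  ?addr0.
by rewrite !(bivectorE _ _ _ yi); ring.
Qed.

Lemma bivector_chart j k I y : y 0 j != 0 ->
  bivector j k I y = y 0 j ^+ 2 * xcomp D j k I y.
Proof.
by move=> yj; rewrite (bivectorE _ _ _ yj) xcomp_diag //
  mulr0 subr0 mulrA -expr2.
Qed.

Variable o : 'I_n.+1.
Hypotheses (n2 : (2 <= n)%N) (o0 : o != ord0).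
Hypotheses
  (N1 : forall j k, xcomp D j k finset.set0 (base j) = 0)
  (N2 : forall k, k != ord0 ->
    xcomp D ord0 k finset.set0 (base ord0 + base k) = 0)
  (N3 : forall k a, k != ord0 -> xcomp D ord0 k [set a] (base ord0) = 0)
  (N4 : forall a, xcomp D o ord0 [set a] (base o) = 0)
  (N5 : forall j a, tcomp D j a finset.set0 (base j) = 0)
  (N6 : forall a b, tcomp D ord0 a [set b] (base ord0) = 0).

Let base1 j : base j 0 j != 0.
Proof. by rewrite baseE eqxx oner_eq0. Qed.

(** The coefficient of t_I has degree 2 - #|I|: four cases according to
    #|I|. *)
Lemma bivector_eq0 I y : y != 0 -> forall j k, bivector j k I y = 0.
Proof.
move=> y0 j k; have [I3|] := ltnP 2 #|I|.
  apply: (weighted_gt _ I3 (@bivector_regular j k I) (@bivector_weighted j k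
    I)) => //.
  exact: leq_trans n2.
have rB i l : regular_fun PT (bivector i l I) by apply: bivector_regular.
have wB i l : weighted #|I| 2 (bivector i l I) by apply: bivector_weighted.
have aB i l z : bivector i l I z = - bivector l i I z by apply: bivector_anti.
have dB i z : bivector i i I z = 0 by apply: bivector_diag.
have cB := bivector_cocycle I.
rewrite leq_eqVlt => /orP[/eqP I2|]; first exact: (bivector_const0 rB wB cB n2
  I2).
rewrite ltnS leq_eqVlt => /orP[/eqP I1|].
  have /eqP/cards1P[a Ia] := I1.
  apply: (bivector_linear0 rB wB aB dB cB I1 o0) => // [|l l0].
    by rewrite bivector_chart // Ia N4 mulr0.
  by rewrite bivector_chart // Ia N3 // mulr0.
rewrite ltnS leqn0 => /eqP I0; have /eqP := I0; rewrite cards_eq0 => /eqP IE.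
apply: (bivector_quadratic0 rB wB aB dB cB I0) => // [i l|l].
  by rewrite bivector_chart // IE N1 mulr0.
have [->|l0] := eqVneq l ord0; first exact: dB.
rewrite bivector_chart ?IE ?N2 ?mulr0 // !mxE !eqxx /= [ord0 == l]eq_sym
  (negbTE l0) addr0.
exact: oner_neq0.
Qed.

Lemma xcomp_eq0 i k I y : y 0 i != 0 -> xcomp D i k I y = 0.
Proof.
move=> yi; have y0 : y != 0 by apply/rV0Pn; exists i.
have /eqP := bivector_eq0 I y0 i k; rewrite bivector_chart // mulf_eq0.
by rewrite expf_eq0 (negbTE yi) andbF => /eqP.
Qed.

(** The coefficient of d/dt_a in the lift of D whose even coefficients are
    zero. *)
Definition oddfield a I y : K :=
  if [pick i | y 0 i != 0] is Some i then y 0 i * tcomp D i a I y else 0.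

Lemma oddfieldE i a I y : y 0 i != 0 -> oddfield a I y = y 0 i * tcomp D i a I
  y.
Proof.
move=> yi; rewrite /oddfield; case: pickP => [l yl|/(_ i)]; last by rewrite yi.
rewrite (tcomp_change _ _ yi yl); first by field.
by move=> J; apply: xcomp_eq0.
Qed.

Lemma oddfield_regular a I : regular_fun PT (oddfield a I).
Proof.
move=> x x0; have /rV0Pn[i xi] := x0.
have Ux : cone (stdchart K i) x by apply/stdchartP.
have rG : regular_fun (stdchart K i) (fun y => y 0 i * tcomp D i a I y).
  by apply: regular_funM; [apply: regular_fun_coord | apply: gval_regular].
have [g [h [hx E]]] := rG x Ux; exists g, h; split=> // y hy.
have [Uy Gy] := E y hy; split; first exact: cone_neq0 Uy.
by move/stdchartP: Uy => yi; rewrite (oddfieldE _ _ yi) -Gy.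
Qed.

Lemma oddfield_weighted a I : weighted #|I| 1 (oddfield a I).
Proof.
move=> l y l0 /rV0Pn[i yi].
have lyi : (l *: y) 0 i != 0 by rewrite mxE mulf_neq0.
rewrite (oddfieldE _ _ yi) (oddfieldE _ _ lyi).
by rewrite -(tcomp_homog a I l0 yi) !mxE; ring.
Qed.

Lemma oddfield_eq0 a I y : y != 0 -> oddfield a I y = 0.
Proof.
move=> y0; have rO := @oddfield_regular a I; have wO := @oddfield_weighted a I.
have [I2|] := ltnP 1 #|I|.
  by apply: (weighted_gt _ I2 rO wO) => //; apply: leq_trans n2.
rewrite leq_eqVlt => /orP[/cards1P[b Ib]|].
  rewrite Ib cards1 in rO wO *.
  rewrite (weighted_const rO wO y0 (base_neq0 K ord0)).
  by rewrite (oddfieldE _ _ (base1 ord0)) N6 mulr0.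
rewrite ltnS leqn0 cards_eq0 => /eqP I0; rewrite I0 cards0 in rO wO *.
apply: (weighted_linear0 rO wO) => // j.
by rewrite (oddfieldE _ _ (base1 j)) N5 mulr0.
Qed.

(** A global derivation is determined by the finitely many scalars in N1, ...,
    N6, the coefficients of a linear vector field without its x_0 d/dx_0
    term. *)
Lemma normalized_eq0 : D = 0.
Proof.
have Dx i k y : cone (stdchart K i) y -> act D (xsec K m i k) y = 0.
  by move=> /stdchartP yi; apply/ffunP => I; rewrite ffunE; apply: xcomp_eq0.
have Dt i a y : cone (stdchart K i) y -> act D (tsec K i a) y = 0.
  move=> /stdchartP yi; apply/ffunP => I; rewrite ffunE.
  have y0 : y != 0 by apply/rV0Pn; exists i.
  have /eqP := oddfield_eq0 a I y0; rewrite (oddfieldE _ _ yi) mulf_eq0 (negbTE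
    yi).
  by move=> /eqP.
apply: functional_extensionality_dep => V.
apply: functional_extensionality_dep => VP; apply: funext => f.
have -> : VP = @subT _ _ V by apply: Prop_irrelevance.
apply: gval_inj => y Vy; rewrite -/(act D f y) (derivation_eq0 HD Dx Dt) //.
by rewrite gval0.
Qed.

End Rigidity.

(** * Linear vector fields *)

Definition parity (A B : Type) (u : A + B) : bool :=
  if u is inr _ then true else false.

Section GermSum.
Variable K : closedFieldType.

Lemma germ_derivC (c : K) : germ_deriv (fun=> c) = 0.
Proof.
rewrite (@germ_derivE _ _ c%:P 1) ?hornerC ?oner_neq0 //.
  by rewrite /fraction_deriv -polyC1 !derivC !hornerC mul0r mulr0 subr0 mul0r.
by move=> s _; rewrite !hornerC divr1.
Qed.

Lemma germC (c : K) : germ (fun=> c).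
Proof.
exists c%:P, 1; rewrite hornerC oner_neq0; split=> // s _.
by rewrite !hornerC divr1.
Qed.

Lemma germ_derivZ (c : K) phi : germ phi ->
  germ_deriv (fun s => c * phi s) = c * germ_deriv phi.
Proof.
by move=> gp; rewrite (germ_derivM (germC c) gp) germ_derivC mul0r add0r.
Qed.

Lemma germ_deriv_sum (T : Type) (r : seq T) (P : pred T) (phi : T -> K -> K) :
  (forall i, germ (phi i)) ->
  germ (fun s => \sum_(i <- r | P i) phi i s) /\
  germ_deriv (fun s => \sum_(i <- r | P i) phi i s) =
  \sum_(i <- r | P i) germ_deriv (phi i).
Proof.
move=> gphi; elim: r => [|i r [IH1 IH2]].
  have -> : (fun s => \sum_(i <- [::] | P i) phi i s) = fun=> 0.
    by apply/funext => s; rewrite big_nil.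
  by rewrite big_nil germ_derivC; split=> //; apply: germC.
have -> : (fun s => \sum_(j <- i :: r | P j) phi j s) =
    if P i then fun s => phi i s + \sum_(j <- r | P j) phi j s
    else fun s => \sum_(j <- r | P j) phi j s.
  by apply/funext => s; rewrite big_cons; case: (P i).
rewrite big_cons; case: (P i) => //; split; first exact: germD.
by rewrite germ_derivD // IH2.
Qed.
End GermSum.

Section VectorFields.
Variables (K : closedFieldType) (n m : nat).
Local Notation point := 'rV[K]_n.+1.
Local Notation PT := (popenT K n).
Local Notation base := (@base K n).
Implicit Types (I J : {set 'I_m}) (y : point) (U V : popen K n) (i j k :
  'I_n.+1).

Lemma regular_germ U (F : point -> K) y v : regular_fun U F -> cone U y ->
  germ (fun s => F (y + s *: v)).
Proof.
move=> rF Uy; have [g [h [hx E]]] := rF y Uy; exists (line y v g), (line y v h).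
rewrite !line_eval scale0r addr0; split=> // s; rewrite !line_eval => hs.
by have [_ ->] := E _ hs.
Qed.

Lemma near_line U y v : cone U y -> exists r : {poly K}, r.[0] != 0 /\
  forall s, r.[s] != 0 -> cone U (y + s *: v).
Proof.
move=> /popen_nbhd[h [hy hU]]; exists (line y v h).
rewrite line_eval scale0r addr0; split=> // s; rewrite line_eval; exact: hU.
Qed.

Definition partial j (F : point -> K) y : K :=
  germ_deriv (fun s => F (y + s *: base j)).

Lemma partial_regular U j F : regular_fun U F -> regular_fun U (partial j F).
Proof.
move=> rF x Ux; have [g [h [hx E]]] := rF x Ux.
exists (g^`M(j) * h - g * h^`M(j)), (h ^+ 2).
have e2 y : evalp (h ^+ 2) y = evalp h y ^+ 2 by rewrite expr2 evalpM -expr2.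
rewrite e2 expf_neq0 //; split=> // y; rewrite e2 expf_eq0 /= => hy.
have [Uy _] := E y hy; split=> //.
rewrite /partial (@germ_derivE _ _ (line y (base j) g) (line y (base j) h)).
- rewrite /fraction_deriv !line_deriv !line_eval scale0r addr0.
  have D f : \sum_i base j 0 i * evalp f^`M(i) y = evalp f^`M(j) y.
    rewrite (bigD1 j) //= big1 ?addr0 ?baseE ?eqxx ?mul1r // => i ij.
    by rewrite baseE (negbTE ij) mul0r.
  by rewrite !D evalpD evalpN !evalpM.
- by rewrite line_eval scale0r addr0.
- by move=> s; rewrite !line_eval => hs; have [] := E _ hs.
Qed.

Lemma partial_local U j F G y : cone U y -> regular_fun U G ->
  (forall z, cone U z -> F z = G z) -> partial j F y = partial j G y.
Proof.
move=> Uy rG FG; have [r [r0 rU]] := near_line (base j) Uy.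
apply: (germ_deriv_local r0); last exact: regular_germ rG Uy.
by move=> s /rU; apply: FG.
Qed.

(** Substitute s / l for s: F (l y + s e_j) = l ^- d * F (y + (s / l) e_j). *)
Lemma partial_homog U d j F : regular_fun U F -> homog_fun U d F ->
  homog_fun U d.+1 (partial j F).
Proof.
move=> rF hF l y l0 Uy; have Uly : cone U (l *: y) by apply: cone_scale.
have gy := regular_germ (base j) rF Uy.
have gly := regular_germ (base j) rF Uly.
have [r [r0 rU]] := near_line (base j) Uy.
rewrite exprSr /partial mulrAC -(germ_derivZ _ gly).
have -> : germ_deriv (fun s => l ^+ d * F (l *: y + s *: base j)) =
    germ_deriv (fun s => (fun s => F (y + s *: base j)) (l^-1 * s)).
  apply: (@germ_deriv_local _ _ _ (r \Po (l^-1 *: 'X))).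
  - by rewrite horner_comp hornerZ hornerX mulr0.
  - move=> s; rewrite horner_comp hornerZ hornerX => /rU Us.
    rewrite -[RHS](hF l) //; congr (_ * F _).
    by rewrite scalerDr scalerA mulrA divff // mul1r.
  - have [g [h [h0 E]]] := gy; exists (g \Po (l^-1 *: 'X)),
    (h \Po (l^-1 *: 'X)).
    rewrite horner_comp hornerZ hornerX mulr0; split=> // s.
    by rewrite !horner_comp !hornerZ !hornerX; apply: E.
by rewrite (germ_deriv_scale l^-1 gy) mulrAC mulVf // mul1r.
Qed.

Local Notation index := ('I_n.+1 + 'I_m)%type.
Implicit Types (u v : index).

(** The derivative d/dz_u and the multiplication by z_v, for z = (x, t); they
    take sections of weight 0 to weight -1 and back. *)
Definition dcoord u U (f : osheaf m U) y : grassmann K m :=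
  match u with
  | inl j => [ffun I : {set 'I_m} => partial j (fun z => gval f z I) y : K^o]
  | inr a => gder a (gval f y)
  end.

Definition mcoord v y (g : grassmann K m) : grassmann K m :=
  match v with inl l => y 0 l *: g | inr b => gtmul b g end.

Lemma dcoord_lin u U c (f g : osheaf m U) y : cone U y ->
  dcoord u (c *: f + g) y = c *: dcoord u f y + dcoord u g y.
Proof.
move=> Uy; case: u => [j|a]; apply/ffunP => I; rewrite gaddE gscaleE !ffunE;
  last first.
  by case: ifP => _; rewrite ?mulr0 ?addr0 // gvalZD gaddE gscaleE; ring.
have gf := regular_germ (base j) (gval_regular f I) Uy.
have gg := regular_germ (base j) (gval_regular g I) Uy.
rewrite /partial -(germ_derivZ _ gf) -germ_derivD //.
  by congr germ_deriv; apply/funext => s; rewrite gvalZD gaddE gscaleE.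
by apply: germM => //; apply: germC.
Qed.

Lemma dcoord_homog u U q (f : osheaf m U) y : (forall y, ghomog q (gval f y)) ->
  ghomog (parity u (+) q) (dcoord u f y).
Proof.
move=> fq; case: u => [j|a] /=; last exact: ghomog_gder.
move=> I Iq; rewrite ffunE /partial -[RHS](germ_derivC (0 : K));
  congr germ_deriv.
by apply/funext => s; apply: fq.
Qed.

Lemma dcoord_leibniz u U q (f g : osheaf m U) y : cone U y ->
  (forall y, ghomog q (gval f y)) ->
  dcoord u (omul f g) y = gmul (dcoord u f y) (gval g y) +
    (-1) ^+ (parity u && q) *: gmul (gval f y) (dcoord u g y).
Proof.
move=> Uy fq; case: u => [j|a] /=; last first.
  by rewrite gval_omul; apply: gder_leibniz.
rewrite scale1r; apply/ffunP => L; rewrite gaddE ffunE !gmulE /partial.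
have gf I := regular_germ (base j) (gval_regular f I) Uy.
have gg I := regular_germ (base j) (gval_regular g I) Uy.
have gfg I J : germ (fun s => gval f (y + s *: base j) I * gval g (y + s *:
  base j) J).
  exact: germM.
have -> : (fun s => gval (omul f g) (y + s *: base j) L) = fun s =>
    \sum_(I : {set 'I_m} | I \subset L) (-1) ^+ inversions I (L :\: I) *
     (gval f (y + s *: base j) I * gval g (y + s *: base j) (L :\: I)).
  apply/funext => s; rewrite gval_omul gmulE; apply: eq_bigr => I _.
  by rewrite mulrA.
rewrite (germ_deriv_sum _ _ _).2 => [|I]; last by apply: germM => //;
  apply: germC.
rewrite -big_split; apply: eq_bigr => I _ /=.
rewrite germ_derivZ // germ_derivM // !ffunE scale0r addr0 /partial.
by rewrite mulrDr !mulrA.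
Qed.

Lemma mcoordDr v y f g : mcoord v y (f + g) = mcoord v y f + mcoord v y g.
Proof.
case: v => [l|b] /=; first exact: scalerDr.
by rewrite -[f + g]gmul1g gtmul_gmull gmulDr -!gtmul_gmull !gmul1g.
Qed.

Lemma mcoordZ v y c f : mcoord v y (c *: f) = c *: mcoord v y f.
Proof.
case: v => [l|b] /=; first by rewrite !scalerA mulrC.
by rewrite -[c *: f]gmul1g gtmul_gmull gmulZr -!gtmul_gmull !gmul1g.
Qed.

Lemma mcoord_homog v y q f : ghomog q f -> ghomog (parity v (+) q) (mcoord v y
  f).
Proof. by case: v => [l|b] fq /=; [apply: ghomogZ | apply: ghomog_gtmul]. Qed.

Lemma mcoord_gmull v y f g : mcoord v y (gmul f g) = gmul (mcoord v y f) g.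
Proof. by case: v => [l|b] /=; rewrite ?gmulZl // gtmul_gmull. Qed.

Lemma mcoord_gmulr v y q f g : ghomog q f ->
  mcoord v y (gmul f g) = (-1) ^+ (parity v && q) *: gmul f (mcoord v y g).
Proof.
case: v => [l|b] fq /=; first by rewrite scale1r gmulZr.
exact: gtmul_gmulr.
Qed.

Fact vfield_subproof u v U (f : osheaf m U) :
  is_section U (fun y => mcoord v y (dcoord u f y)).
Proof.
have P I : regular_fun U (fun y => dcoord u f y I : K) /\
    homog_fun U #|I|.+1 (fun y => dcoord u f y I : K).
  case: u => [j|a] /=.
    have -> : (fun y => [ffun I0 : {set 'I_m} => partial j ((gval f)^~ I0) y :
      K^o] I : K) =
      partial j (fun z => gval f z I) by apply/funext => y; rewrite ffunE.
    split; first exact/partial_regular/gval_regular.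
    by apply: partial_homog; [apply: gval_regular | apply: gval_homog].
  have [aI|aI] := boolP (a \in I).
    have -> : (fun y => gder a (gval f y) I : K) = fun=> 0.
      by apply/funext => y; rewrite gder0.
    by split; [apply: regular_funC | move=> l y _ _; rewrite mulr0].
  have -> : (fun y => gder a (gval f y) I : K) =
      fun y => (-1) ^+ below a I * (gval f y (a |: I) : K).
    by apply/funext => y; rewrite gderU.
  split; first by apply: regular_funM; [apply: regular_funC | apply:
    gval_regular].
  move=> l y l0 Uy; rewrite mulrCA; congr (_ * _).
  by have := gval_homog f (a |: I) l0 Uy; rewrite cardsU1 aI.
move=> I; case: v => [l|b] /=.
  have -> : (fun y => (y 0 l *: dcoord u f y) I : K) =
      fun y => y 0 l * (dcoord u f y I : K) by apply/funext => y;
        rewrite gscaleE.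
  have [rP hP] := P I.
  split; first by apply: regular_funM rP; apply: regular_fun_coord.
  move=> c y c0 Uy; rewrite -(hP c y) // mxE exprSr; ring.
have [bI|bI] := boolP (b \in I); last first.
  have -> : (fun y => gtmul b (dcoord u f y) I : K) = fun=> 0.
    by apply/funext => y; rewrite gtmul0.
  by split; [apply: regular_funC | move=> l y _ _; rewrite mulr0].
have -> : (fun y => gtmul b (dcoord u f y) I : K) =
    fun y => (-1) ^+ below b I * (dcoord u f y (I :\ b) : K).
  by apply/funext => y; rewrite ffunE bI.
have [rP hP] := P (I :\ b); split; first by apply: regular_funM rP;
  apply: regular_funC.
move=> l y l0 Uy; rewrite mulrCA; congr (_ * _).
by rewrite -(hP l y) // [in LHS](cardsD1 b) bI.
Qed.

(** The linear vector field z_v d/dz_u. *)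
Definition vfield u v : operation m PT :=
  fun U _ f => mksec (@vfield_subproof u v U f).

Lemma gval_vfield u v U UP (f : osheaf m U) y : cone U y ->
  gval (@vfield u v U UP f) y = mcoord v y (dcoord u f y).
Proof. by move=> Uy; rewrite gval_mksec. Qed.

Lemma vfield_superderivation u v :
  superderivation (parity u (+) parity v) (vfield u v).
Proof.
split.
- move=> V VW c f g; apply: gval_inj => y Vy.
  by rewrite gvalZD !gval_vfield // dcoord_lin // mcoordDr mcoordZ.
- move=> V V' VW V'W V'V f; apply: gval_inj => y V'y.
  rewrite gval_ores // !gval_vfield //; last exact: V'V.
  congr mcoord; case: u => [j|a] /=; last by rewrite gval_ores.
  apply/ffunP => I; rewrite !ffunE; apply/esym/(partial_local j V'y).
    exact: regular_fun_sub V'V (gval_regular f I).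
  by move=> z Vz; rewrite gval_ores.
- move=> V VW q f /homogeneousP fq; apply/homogeneousP => y.
  have [Vy|Vy] := pselect (cone V y); last by rewrite gval_out //;
    apply: ghomog0.
  rewrite gval_vfield // [parity u (+) _]addbC -addbA.
  exact/mcoord_homog/dcoord_homog.
- move=> V VW q f g /homogeneousP fq; apply: gval_inj => y Vy.
  rewrite [in RHS]addrC gvalZD !gval_omul !gval_vfield // [RHS]addrC.
  rewrite (dcoord_leibniz _ _ Vy fq) mcoordDr mcoordZ mcoord_gmull.
  rewrite (mcoord_gmulr _ _ _ (fq y)) scalerA -signr_addb; congr (_ + _ *: _).
  by congr (_ ^+ nat_of_bool _); case: (parity u) (parity v) q {fq} => [] [] [].
Qed.

End VectorFields.

(** * The matrix of a derivation *)

Section Coefficients.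
Variables (K : closedFieldType) (n m : nat).
Local Notation point := 'rV[K]_n.+1.
Local Notation PT := (popenT K n).
Local Notation base := (@base K n).
Local Notation index := ('I_n.+1 + 'I_m)%type.
Local Notation gone := (gone K m).
Implicit Types (I J : {set 'I_m}) (y : point) (i j k : 'I_n.+1) (u v : index).
Implicit Types (D : operation m PT).

Lemma gderZ a c (f : grassmann K m) : gder a (c *: f) = c *: gder a f.
Proof.
apply/ffunP => I; rewrite gscaleE; have [aI|aI] := boolP (a \in I).
  by rewrite !gder0 ?mulr0.
by rewrite !gderU // gscaleE mulrCA.
Qed.

Lemma gder_gone a : gder a gone = 0.
Proof.
apply/ffunP => I; have [aI|aI] := boolP (a \in I);
  first by rewrite gder0 ?ffunE.
rewrite gderU // !ffunE [_ == _](_ : _ = false) ?mulr0 //.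
by apply/eqP => E; have := finset.in_set0 a; rewrite -E setU11.
Qed.

Lemma gder_gtmul_gone b a : gder b (gtmul a gone) = (a == b)%:R *: gone.
Proof.
rewrite -gbasis0 gtmul_gbasis ?inE // setU0 gderZ.
have below0 c : below c finset.set0 = 0%N by rewrite /below big_set0.
rewrite below0 expr0 scale1r; apply/ffunP => I; rewrite gscaleE.
have [bI|bI] := boolP (b \in I).
  rewrite gder0 // ffunE [_ == finset.set0](_ : _ = false) ?mulr0 //.
  by apply/eqP => E; rewrite E inE in bI.
rewrite gderU // !ffunE; have [->|nI] := eqVneq I finset.set0.
  by rewrite setU0 (inj_eq set1_inj) below0 mul1r mulr1 eq_sym.
rewrite [_ == [set a]](_ : _ = false) ?mulr0 //; apply/eqP => E.
have /set0Pn[c cI] := nI; have cb : c != b by apply: contraNneq bI => <-.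
have : c \in [set a] by rewrite -E !inE cI orbT.
have : b \in [set a] by rewrite -E !inE eqxx.
by rewrite !inE => /eqP <- /eqP E'; rewrite E' eqxx in cb.
Qed.

Lemma dcoord_xsec u i k y : y 0 i != 0 -> dcoord u (xsec K m i k) y =
  (if u is inl j then ((k == j)%:R * y 0 i - y 0 k * (i == j)%:R) / y 0 i ^+ 2
   else 0) *: gone.
Proof.
move=> yi; case: u => [j|a] /=; last first.
  by rewrite gval_xsec // gderZ gder_gone scaler0 scale0r.
apply/ffunP => I; rewrite gscaleE ffunE /partial; set c := (gone I : K).
rewrite (@germ_derivE _ _ (((y 0 k)%:P + (k == j)%:R *: 'X) * c%:P)
  ((y 0 i)%:P + (i == j)%:R *: 'X)).
- rewrite /fraction_deriv !derivE !(hornerD, hornerM, hornerZ, hornerC,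
  hornerX).
  rewrite ?(mulr0, addr0, add0r, mulr1); field; exact: yi.
- by rewrite hornerD hornerZ hornerC hornerX mulr0 addr0.
- move=> s; rewrite !(hornerD, hornerM, hornerZ, hornerC, hornerX) => hs.
  have E l : (y + s *: base j) 0 l = y 0 l + (l == j)%:R * s.
    by rewrite !mxE eqxx /= mulrC.
  by rewrite gval_xsec ?E // gscaleE mulrAC.
Qed.

Lemma dcoord_tsec u i a y : y 0 i != 0 -> dcoord u (tsec K i a) y =
  if u is inl j then (- (i == j)%:R / y 0 i ^+ 2) *: gtmul a gone
  else ((inr a == u)%:R / y 0 i) *: gone.
Proof.
move=> yi; case: u => [j|b] /=; last first.
  by rewrite gval_tsec // gderZ gder_gtmul_gone scalerA mulrC.
apply/ffunP => I; rewrite gscaleE ffunE /partial; set c := (gtmul a gone I : K).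
rewrite (@germ_derivE _ _ c%:P ((y 0 i)%:P + (i == j)%:R *: 'X)).
- rewrite /fraction_deriv !derivE !(hornerD, hornerM, hornerZ, hornerC,
  hornerX).
  rewrite ?horner0 ?(mulr0, addr0, add0r, mulr1, mul0r); field; exact: yi.
- by rewrite hornerD hornerZ hornerC hornerX mulr0 addr0.
- move=> s; rewrite !(hornerD, hornerM, hornerZ, hornerC, hornerX) => hs.
  have E l : (y + s *: base j) 0 l = y 0 l + (l == j)%:R * s.
    by rewrite !mxE eqxx /= mulrC.
  by rewrite gval_tsec ?E // gscaleE mulrC.
Qed.

(** The coefficient of t_I in the coordinate z_v. *)
Definition zcoord v y I : K := mcoord v y gone I.

Lemma zcoord0 v y : zcoord v y finset.set0 = if v is inl l then y 0 l else 0.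
Proof.
case: v => [l|b]; rewrite /zcoord /=; first by rewrite gscaleE ffunE eqxx mulr1.
by rewrite gtmul0 // inE.
Qed.

Lemma gtmul_gone1 b a : gtmul b gone [set a] = (a == b)%:R.
Proof.
rewrite -gbasis0 gtmul_gbasis ?inE // gscaleE ffunE setU0 /below big_set0.
by rewrite expr0 mul1r (inj_eq set1_inj).
Qed.

Lemma zcoord1 v y a : zcoord v y [set a] = (inr a == v)%:R.
Proof.
case: v => [l|b]; rewrite /zcoord /=; last by rewrite gtmul_gone1.
rewrite gscaleE ffunE [_ == finset.set0](_ : _ = false) ?mulr0 //.
by apply/eqP => E; have := finset.in_set0 a; rewrite -E set11.
Qed.

Lemma xcomp_vfield u v i k I y : y 0 i != 0 -> xcomp (vfield u v) i k I y =
  (if u is inl j then ((k == j)%:R * y 0 i - y 0 k * (i == j)%:R) / y 0 i ^+ 2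
   else 0) * zcoord v y I.
Proof.
move=> yi; rewrite /xcomp /act gval_vfield; last exact/stdchartP.
by rewrite dcoord_xsec // mcoordZ gscaleE.
Qed.

Lemma tcomp_vfield u v i a I y : y 0 i != 0 -> tcomp (vfield u v) i a I y =
  if u is inl j then - (i == j)%:R / y 0 i ^+ 2 * (mcoord v y (gtmul a gone) I
    : K)
  else (inr a == u)%:R / y 0 i * zcoord v y I.
Proof.
move=> yi; rewrite /tcomp /act gval_vfield; last exact/stdchartP.
by rewrite dcoord_tsec //; case: u => [j|b]; rewrite mcoordZ gscaleE.
Qed.

(* Any index other than 0: the coefficients of t_b d/dx_0 are read off at
   e_o. *)
Variable o : 'I_n.+1.

(** The coefficient of z_v d/dz_u in the linear lift of D without x_0 d/dx_0
    term, read off at points where one term of D (x_k / x_i) or D (t_a / x_i)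
    survives. On the diagonal, D (x_k / x_0) at e_0 + e_k is M_kk + M_k0 -
    M_0k. *)
Definition coef D u v : K :=
  match u, v with
  | inl k, inl j =>
    if k == j then
      if k == ord0 then 0
      else xcomp D ord0 k finset.set0 (base ord0 + base k)
        - xcomp D ord0 k finset.set0 (base ord0)
        + xcomp D k ord0 finset.set0 (base k)
    else xcomp D j k finset.set0 (base j)
  | inl k, inr a =>
    if k == ord0 then xcomp D o k [set a] (base o)
    else xcomp D ord0 k [set a] (base ord0)
  | inr a, inl j => tcomp D j a finset.set0 (base j)
  | inr a, inr b => tcomp D ord0 a [set b] (base ord0)
  end.

Lemma xcomp_lin c D E i k I y :
  xcomp (c *: D + E) i k I y = c * xcomp D i k I y + xcomp E i k I y.
Proof.
rewrite /xcomp /act -[(c *: D + E) _ _ _]/(c *: D _ _ _ + E _ _ _).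
by rewrite gvalZD gaddE gscaleE.
Qed.

Lemma tcomp_lin c D E i a I y :
  tcomp (c *: D + E) i a I y = c * tcomp D i a I y + tcomp E i a I y.
Proof.
rewrite /tcomp /act -[(c *: D + E) _ _ _]/(c *: D _ _ _ + E _ _ _).
by rewrite gvalZD gaddE gscaleE.
Qed.

Lemma coef_lin c D E u v : coef (c *: D + E) u v = c * coef D u v + coef E u v.
Proof.
case: u v => [k|a] [j|b] /=; rewrite ?tcomp_lin //.
  by do 2?[case: ifP => _]; rewrite ?xcomp_lin //; ring.
by case: ifP => _; rewrite xcomp_lin.
Qed.

Let base1 j : base j 0 j != 0.
Proof. by rewrite baseE eqxx oner_eq0. Qed.

Lemma coef_vfield u v u' v' : o != ord0 -> (u, v) != (inl ord0, inl ord0) ->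
  coef (vfield u v) u' v' = ((u' == u) && (v' == v))%:R.
Proof.
move=> o0 uv0.
have inlE (k j : 'I_n.+1) : (inl k == inl j :> index) = (k == j) by [].
have inrE (a b : 'I_m) : (inr a == inr b :> index) = (a == b) by [].
case: u' v' => [k|a] [j|b] /=.
- have [<-|kj] := eqVneq k j; last first.
    rewrite xcomp_vfield // zcoord0.
    case: u uv0 => [j'|a] _; last by rewrite mul0r.
    rewrite !baseE eqxx (negbTE kj) expr1n divr1 mulr1 mul0r subr0 inlE.
    case: v => [l|b]; last by rewrite mulr0 andbF.
    by rewrite inlE baseE [l == j]eq_sym -natrM mulnb.
  have [k0|k0] := eqVneq k ord0.
    rewrite k0 [_ && _](_ : _ = false) //.
    by apply: contraNF uv0 => /andP[/eqP <- /eqP <-].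
  have k0' : (ord0 == k) = false by rewrite eq_sym (negbTE k0).
  have y00 : (base ord0 + base k) 0 ord0 != 0.
    by rewrite !mxE !eqxx /= k0' addr0 oner_neq0.
  rewrite !xcomp_vfield // !zcoord0.
  case: u uv0 => [j'|a] uv0; last by rewrite !mul0r subrr addr0.
  rewrite !inlE !mxE !eqxx /= k0' (negbTE k0) /= !(addr0, add0r, mulr1, mul1r,
    mul0r, subr0).
  rewrite !expr1n !divr1.
  case: v uv0 => [l|b] uv0; last by rewrite !mulr0 subrr addr0 andbF.
  rewrite !inlE ?mxE /=.
  have z0 : (ord0 == j')%:R * (l == ord0)%:R = 0 :> K.
    rewrite -natrM mulnb [_ && _](_ : _ = false) //.
    by apply: contraNF uv0 => /andP[/eqP <- /eqP <-].
  rewrite -mulnb natrM [k == l]eq_sym; apply/eqP; rewrite -subr_eq0 -oppr0 -z0.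
  by apply/eqP; ring.
- have gen i : i != k ->
      xcomp (vfield u v) i k [set b] (base i) = ((inl k == u) && (inr b ==
        v))%:R.
    move=> ik; rewrite xcomp_vfield // zcoord1.
    case: u uv0 => [j|a] _; last by rewrite mul0r.
    rewrite !baseE eqxx [k == i]eq_sym (negbTE ik) expr1n divr1 mulr1 mul0r
      subr0.
    by rewrite inlE -natrM mulnb.
  case: eqP => [k0|/eqP k0]; apply: gen; first by rewrite k0.
  by rewrite eq_sym.
- rewrite tcomp_vfield // zcoord0; case: u uv0 => [k|b] uv0.
    case: v {uv0} => [l|b] /=; last by rewrite gtmul0 ?inE ?mulr0.
    by rewrite gscaleE gtmul0 ?inE ?mulr0.
  rewrite baseE eqxx divr1 inrE; case: v uv0 => [l|c] _;
    last by rewrite mulr0 andbF.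
  by rewrite inlE baseE eq_sym -natrM mulnb [l == j]eq_sym andbC.
- rewrite tcomp_vfield // zcoord1; case: u uv0 => [k|c] uv0; last first.
    by rewrite inrE baseE eqxx divr1 -natrM mulnb.
  case: v uv0 => [l|c] uv0 /=.
    rewrite gscaleE [base ord0 0 l]baseE.
    have z0 : (l == ord0)%:R * (ord0 == k)%:R = 0 :> K.
      rewrite -natrM mulnb [_ && _](_ : _ = false) //.
      by apply: contraNF uv0 => /andP[/eqP -> /eqP <-].
    transitivity (- ((l == ord0)%:R * (ord0 == k)%:R) / base ord0 0 ord0 ^+ 2 *
      (gtmul a gone [set b] : K)); first by ring.
    by rewrite z0 oppr0 !mul0r.
  rewrite [X in _ * X](_ : _ = 0) ?mulr0 //.
  rewrite ffunE inE; have [cb|//] := eqVneq c b.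
  by rewrite cb setDv gtmul0 ?mulr0 // inE.
Qed.

End Coefficients.

(** * Dimensions of spaces of supermatrices *)

Section Dimension.
Variable K : fieldType.

(** The coordinates of f x in a basis of W. *)
Lemma has_dim_vspace (V : lmodType K) (vT : vectType K) (W : {vspace vT})
    (f : V -> vT) : linear f -> injective f -> (forall x, f x \in W) ->
  (forall w, w \in W -> exists x, f x = w) -> has_dim V (\dim W).
Proof.
move=> fl fi fW fs; constructor.
pose g (r : 'rV[K]_(\dim W)) := \sum_i r 0 i *: (vbasis W)`_i.
have gW r : g r \in W.
  by apply: memv_suml => i _; apply: memvZ; apply: vbasis_mem; apply: memt_nth.
exists (fun x => \row_i coord (vbasis W) i (f x)).
  by move=> c x y; apply/rowP => i; rewrite !mxE fl linearP.
exists (fun r => sval (cid (fs _ (gW r)))) => [x|r].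
  case: cid => y /= E; apply: fi; rewrite E /g [RHS](coord_vbasis (fW x)).
  by apply: eq_bigr => i _; rewrite mxE.
case: cid => y /= E; apply/rowP => i; rewrite mxE E.
by rewrite /g coord_sum_free // (basis_free (vbasisP W)).
Qed.

Lemma dim_image (aT vT : vectType K) (W : {vspace vT}) (f : {linear aT -> vT}) :
  injective f -> (forall x, f x \in W) -> (forall w, w \in W -> exists x,
    f x = w) ->
  \dim W = dim aT.
Proof.
move=> fi fW fs; have -> : W = (linfun f @: fullv)%VS.
  apply/vspaceP => w; apply/idP/memv_imgP => [/fs[x <-]|[x _ ->]].
    by exists x; rewrite ?memvf // lfunE.
  by rewrite lfunE.
rewrite limg_dim_eq ?dimvf //; apply/eqP; rewrite capfv; apply/lker0P => x y.
by rewrite !lfunE; apply: fi.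
Qed.

Lemma dim_hyperplane (vT : vectType K) (W : {vspace vT}) (f : {linear vT ->
  K^o}) w :
  w \in W -> f w != 0 -> (\dim (W :&: lker (linfun f))).+1 = \dim W.
Proof.
move=> wW fw; rewrite -(limg_ker_dim (linfun f) W) -addn1; congr (_ + _)%N.
apply/eqP; rewrite eqn_leq; apply/andP; split.
  rewrite lt0n dimv_eq0; apply: contra fw => /eqP E.
  have : linfun f w \in (linfun f @: W)%VS by apply: memv_img.
  by rewrite E memv0 lfunE.
by apply: leq_trans (dimvS (subvf _)) _; rewrite dimvf.
Qed.

End Dimension.

Section SuperMatrices.
Variables (K : fieldType) (p q : nat).
Local Notation mx := 'M[K]_(p + q).

Definition block_even (X : 'M[K]_p * 'M[K]_q) : mx := block_mx X.1 0 0 X.2.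
Definition block_odd (X : 'M[K]_(p, q) * 'M[K]_(q, p)) : mx :=
  block_mx 0 X.1 X.2 0.

Lemma block_even_linear : linear block_even.
Proof.
by move=> c A B; rewrite /block_even scale_block_mx add_block_mx !scaler0
  !addr0.
Qed.

Lemma block_odd_linear : linear block_odd.
Proof.
by move=> c A B; rewrite /block_odd scale_block_mx add_block_mx !scaler0 !addr0.
Qed.

HB.instance Definition _ :=
  GRing.isLinear.Build K _ _ *:%R block_even block_even_linear.
HB.instance Definition _ :=
  GRing.isLinear.Build K _ _ *:%R block_odd block_odd_linear.

Definition parity_mx (b : bool) : {vspace mx} :=
  if b then lker (linfun (@evenpart K p q)) else lker (linfun (@oddpart K p q)).

Lemma mem_parity_mx b (A : mx) :
  (A \in parity_mx b) = ((if b then evenpart A else oddpart A) == 0).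
Proof. by case: b; rewrite memv_ker lfunE. Qed.

Lemma parity_mxP b (A : mx) :
  reflect (forall u v : 'I_p + 'I_q, parity u (+) parity v != b ->
            A (unsplit u) (unsplit v) = 0) (A \in parity_mx b).
Proof.
rewrite mem_parity_mx; apply: (iffP idP) => [|H].
  case: b; rewrite block_mx_eq0 => /and4P[].
    move=> /eqP ul _ _ /eqP dr [i|i] [j|j] //= _.
      by have := congr1 (fun M : 'M_p => M i j) ul; rewrite !mxE.
    by have := congr1 (fun M : 'M_q => M i j) dr; rewrite !mxE.
  move=> _ /eqP ur /eqP dl _ [i|i] [j|j] //= _.
    by have := congr1 (fun M : 'M_(p, q) => M i j) ur; rewrite !mxE.
  by have := congr1 (fun M : 'M_(q, p) => M i j) dl; rewrite !mxE.
case: b H => H; rewrite block_mx_eq0 !eqxx /= ?andbT.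
  apply/andP; split; apply/eqP/matrixP => i j; rewrite !mxE.
    exact: (H (inl i) (inl j)).
  exact: (H (inr i) (inr j)).
apply/andP; split; apply/eqP/matrixP => i j; rewrite !mxE.
  exact: (H (inl i) (inr j)).
exact: (H (inr i) (inl j)).
Qed.

Lemma dim_even : \dim (parity_mx false) = (p * p + q * q)%N.
Proof.
rewrite (@dim_image _ _ _ _ block_even) //.
- by move=> [A B] [A' B'] /eq_block_mx[/= -> _ _ ->].
- move=> [A B]; rewrite mem_parity_mx /oddpart /block_even.
  by rewrite block_mxKur block_mxKdl block_mx0.
- move=> A; rewrite mem_parity_mx block_mx_eq0 => /and4P[_ /eqP ur /eqP dl _].
  by exists (ulsubmx A, drsubmx A); rewrite /block_even /= -[RHS]submxK ur dl.
Qed.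

Lemma dim_odd : \dim (parity_mx true) = (p * q + q * p)%N.
Proof.
rewrite (@dim_image _ _ _ _ block_odd) //.
- by move=> [A B] [A' B'] /eq_block_mx[/= _ -> -> _].
- move=> [A B]; rewrite mem_parity_mx /evenpart /block_odd.
  by rewrite block_mxKul block_mxKdr block_mx0.
- move=> A; rewrite mem_parity_mx block_mx_eq0 => /and4P[/eqP ul _ _ /eqP dr].
  by exists (ursubmx A, dlsubmx A); rewrite /block_odd /= -[RHS]submxK ul dr.
Qed.

End SuperMatrices.

Section SlDim.
Variables (K : fieldType) (n m : nat).
Local Notation mx := 'M[K]_(n.+1 + m).

Definition corner (A : mx) : K^o := A (lshift m ord0) (lshift m ord0).

Lemma corner_linear : linear corner.
Proof. by move=> c A B; rewrite /corner !mxE. Qed.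

HB.instance Definition _ := GRing.isLinear.Build K mx K^o *:%R corner
  corner_linear.

(** Representatives of the supermatrices of parity b modulo scalar matrices;
    unlike supertrace zero, the condition defines a complement of the scalars
    also when n + 1 = m. *)
Definition normal_mx (b : bool) : {vspace mx} :=
  (parity_mx K n.+1 m b :&: lker (linfun corner))%VS.

Let unit_mx : mx := delta_mx (lshift m ord0) (lshift m ord0).

Let unit_even : unit_mx \in parity_mx K n.+1 m false.
Proof.
apply/parity_mxP => u v; rewrite mxE => uv.
have inj : injective (@unsplit n.+1 m) := can_inj (@unsplitK _ _).
case: andP => // -[/eqP Eu /eqP Ev]; move: uv.
by rewrite (inj u (inl ord0) Eu) (inj v (inl ord0) Ev).
Qed.

Lemma dim_normal_even : \dim (normal_mx false) = (n ^ 2 + m ^ 2 + 2 * n)%N.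
Proof.
apply: succn_inj; rewrite (dim_hyperplane unit_even).
  rewrite dim_even; ring.
by rewrite /= /corner /unit_mx mxE !eqxx oner_neq0.
Qed.

Lemma dim_normal_odd : \dim (normal_mx true) = (2 * n * m + 2 * m)%N.
Proof.
rewrite /normal_mx (_ : (_ :&: _)%VS = parity_mx K n.+1 m true);
  first by rewrite dim_odd; ring.
apply/capv_idPl/subvP => A /parity_mxP H; rewrite memv_ker lfunE /=.
by apply/eqP; apply: (H (inl ord0) (inl ord0)).
Qed.

Lemma sl_sdimE : sl_sdim K n.+1 m = (n ^ 2 + m ^ 2 + 2 * n,
  2 * n * m + 2 * m)%N.
Proof.
rewrite /sl_sdim; congr (_, _); rewrite capvC.
  apply: succn_inj; rewrite -[lker (linfun (@oddpart _ _ _))]/(parity_mx K n.+1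
    m false).
  rewrite (dim_hyperplane unit_even); first by rewrite dim_even; ring.
  rewrite /= /supertrace /mxtrace (bigD1 ord0) //= big1 => [|i i0]; last first.
    by rewrite !mxE (inj_eq (@lshift_inj _ _)) (negbTE i0).
  rewrite big1 => [|i _]; last by rewrite !mxE eq_rlshift.
  by rewrite !mxE !eqxx addr0 subr0 oner_neq0.
rewrite -[lker (linfun (@evenpart _ _ _))]/(parity_mx K n.+1 m true).
rewrite (_ : (_ :&: _)%VS = parity_mx K n.+1 m true); first by rewrite dim_odd;
  ring.
apply/capv_idPl/subvP => A /parity_mxP H; rewrite memv_ker lfunE /= /supertrace.
rewrite /mxtrace !big1 ?subrr // => i _; rewrite !mxE.
  exact: (H (inr i) (inr i)).
exact: (H (inl i) (inl i)).
Qed.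

End SlDim.

(** * Global derivations and supermatrices *)

Section TangentDimension.
Variables (K : closedFieldType) (n m : nat) (p : bool).
Hypothesis n2 : (2 <= n)%N.
Local Notation PT := (popenT K n).
Local Notation index := ('I_n.+1 + 'I_m)%type.
Local Notation tan := (tangent m p PT).
Implicit Types (u v : index).

Let o : 'I_n.+1 := inord 1.

Let o_neq0 : o != ord0.
Proof. by rewrite -val_eqE /= inordK // ltnS; apply: leq_trans n2. Qed.

Let tan_superder (D : tan) : superderivation p (Defs.tval D).
Proof. by apply/asboolP; apply: (valP D). Qed.

Definition coef_mx (D : tan) : 'M[K]_(n.+1 + m) :=
  \matrix_(x, y) coef o (Defs.tval D) (split x) (split y).

Lemma coef_mxE D u v : coef_mx D (unsplit u) (unsplit v) = coef o (Defs.tval D)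
  u v.
Proof. by rewrite mxE !unsplitK. Qed.

Lemma coef_mx_linear : linear coef_mx.
Proof.
move=> c D E; apply/matrixP => x y; rewrite !mxE -coef_lin.
by rewrite -[Defs.tval (c *: D + E)]/(\val (c *: D + E)) linearP.
Qed.

Lemma coef_mx_inj : injective coef_mx.
Proof.
suff ker0 (D : tan) : (forall u v, coef o (Defs.tval D) u v = 0) ->
  Defs.tval D = 0.
  move=> D E DE; apply/eqP; rewrite -subr_eq0; apply/eqP/val_inj.
  rewrite raddf0; apply: ker0 => u v; rewrite -coef_mxE.
  have -> : D - E = (-1) *: E + D by rewrite scaleN1r addrC.
  by rewrite coef_mx_linear DE scaleN1r addNr mxE.
move=> c0; have HD := tan_superder D.
have N1 j k : xcomp (Defs.tval D) j k finset.set0 (base K j) = 0.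
  have [<-|jk] := eqVneq k j; last by have := c0 (inl k) (inl j);
    rewrite /= (negbTE jk).
  by rewrite (xcomp_diag HD) // baseE eqxx oner_neq0.
apply: (normalized_eq0 HD n2 o_neq0) => //.
- move=> k k0; have := c0 (inl k) (inl k).
  by rewrite /= eqxx (negbTE k0) !N1 subr0 addr0.
- by move=> k a k0; have := c0 (inl k) (inr a); rewrite /= (negbTE k0).
- by move=> a; have := c0 (inl ord0) (inr a).
- by move=> j a; have := c0 (inr a) (inl j).
- by move=> a b; have := c0 (inr a) (inr b).
Qed.

Lemma coef_parity (D : operation m PT) u v : superderivation p D ->
  parity u (+) parity v != p -> coef o D u v = 0.
Proof.
move=> HD; have xe i k (I : {set 'I_m}) y : odd #|I| != p ->
  xcomp D i k I y = 0.
  move=> Ip; apply: (act_homog HD (f := xsec K m i k) (q := false)).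
    exact: xsec_even.
  by rewrite addbF.
have te i a (I : {set 'I_m}) y : odd #|I| == p -> tcomp D i a I y = 0.
  move=> Ip; apply: (act_homog HD (f := tsec K i a) (q := true)).
    exact: tsec_odd.
  by rewrite (eqP Ip) addbT; case: (p).
have e0 : odd #|@finset.set0 'I_m| = false by rewrite cards0.
have e1 (a : 'I_m) : odd #|[set a]| = true by rewrite cards1.
case: u v => [k|a] [j|b] /= uv.
- by rewrite !xe ?e0 // subrr addr0; do 2?case: ifP.
- by rewrite !xe ?e1 //; case: ifP.
- by rewrite te // e0; case: (p) uv.
- by rewrite te // e1; case: (p) uv.
Qed.

Lemma coef_mx_normal D : coef_mx D \in normal_mx K n m p.
Proof.
rewrite memv_cap; apply/andP; split.
  apply/parity_mxP => u v uv; rewrite coef_mxE.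
  by apply: coef_parity (tan_superder D) _; case: u v uv => [?|?] [?|?].
rewrite memv_ker lfunE /= /corner.
by rewrite -[lshift m ord0]/(unsplit (inl ord0 : index)) coef_mxE.
Qed.

(** M is the coefficient matrix of the sum of the M_uv * z_v d/dz_u. *)
Lemma coef_mx_surj M : M \in normal_mx K n m p -> exists D, coef_mx D = M.
Proof.
rewrite memv_cap memv_ker lfunE /= => /andP[/parity_mxP Mp /eqP M0].
pose Phi : operation m PT := \sum_(u : index) \sum_(v : index | parity u (+)
  parity v == p)
  M (unsplit u) (unsplit v) *: vfield u v.
have tPhi : Phi \in @tangent_pred K n m p PT.
  apply: rpred_sum => u _; apply: rpred_sum => v /eqP uv; apply: rpredZ.
  by apply/asboolP; rewrite -uv; apply: vfield_superderivation.
exists (Tangent tPhi); apply/matrixP => x y.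
rewrite -[x]splitK -[y]splitK; set u := split x; set v := split y.
rewrite coef_mxE /=.
have coefD (E F : operation m PT) : coef o (E + F) u v = coef o E u v + coef o
  F u v.
  by rewrite -[E]scale1r coef_lin mul1r scale1r.
have coef0 : coef o (0 : operation m PT) u v = 0.
  by apply/(addrI (coef o (0 : operation m PT) u v)); rewrite -coefD !addr0.
have coefZ c (E : operation m PT) : coef o (c *: E) u v = c * coef o E u v.
  by rewrite -[c *: E]addr0 coef_lin coef0 addr0.
rewrite /Phi (big_morph (fun E => coef o E u v) coefD coef0).
have term u' v' : coef o (M (unsplit u') (unsplit v') *: vfield u' v') u v =
    M (unsplit u') (unsplit v') * ((u == u') && (v == v'))%:R.
  rewrite coefZ; have [[-> ->]|uv0] := eqVneq (u', v') (inl ord0, inl ord0).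
    by rewrite [M _ _]M0 !mul0r.
  by rewrite coef_vfield.
rewrite (bigD1 u) //= [X in _ + X]big1 ?addr0 => [|u' u'u]; last first.
  rewrite (big_morph (fun E => coef o E u v) coefD coef0) big1 // => v' _.
  by rewrite term eq_sym (negbTE u'u) mulr0.
rewrite (big_morph (fun E => coef o E u v) coefD coef0).
have [uv|uv] := eqVneq (parity u (+) parity v) p.
  rewrite (bigD1 v) ?uv //= big1 ?addr0 ?term ?eqxx ?mulr1 //.
  by move=> v' /andP[_ v'v]; rewrite term eqxx eq_sym (negbTE v'v) mulr0.
rewrite big1 => [|v' uv']; last first.
  rewrite term eqxx; have [E|] := eqVneq v v'; last by rewrite mulr0.
  by rewrite E uv' in uv.
by rewrite Mp //; case: u v uv {coefD coef0 coefZ term} => [?|?] [?|?].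
Qed.

Lemma tangent_dim : has_dim (tangent m p PT) (\dim (normal_mx K n m p)).
Proof.
apply: has_dim_vspace coef_mx_linear coef_mx_inj coef_mx_normal coef_mx_surj.
Qed.

End TangentDimension.

Local Close Scope ring_scope.

Theorem mainTheorem7 (R : realType) (n m : nat) :
  2 <= n ->
  h0_tangent R[i] n m (n ^ 2 + m ^ 2 + 2 * n) (2 * n * m + 2 * m) /\
  sl_sdim R[i] n.+1 m = (n ^ 2 + m ^ 2 + 2 * n, 2 * n * m + 2 * m).
Proof.
move=> n2; split; last exact: sl_sdimE.
split; first by rewrite -(dim_normal_even R[i]); apply: tangent_dim.
by rewrite -(dim_normal_odd R[i]); apply: tangent_dim.
Qed.
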